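(* For $n\ge3$, the automorphism group $\operatorname{Aut}(KQ(n))$ of the Kac algebra $KQ(n)$ is $$A_{2n}=\{\Theta_k,\ \Theta_k\Theta'\ \mid\ k \text{ coprime to } 2n\}.$$ In particular, it is of order $2\varphi(2n)$ (where $\varphi$ is the Euler function), and isomorphic to $\mathbb{Z}_{2n}^*\rtimes\mathbb{Z}_2$, where $\mathbb{Z}_{2n}^*$ is the multiplicative group of units of $\mathbb{Z}_{2n}$.
   Context: A finite-dimensional Kac algebra is a finite-dimensional $C^*$-algebra $K$ with a Hopf algebra structure $(\Delta,\varepsilon,S)$ for which $\Delta$ is a $*$-homomorphism; automorphisms are $*$-algebra automorphisms compatible with the coproduct. $KQ(n)$ ($n\ge1$): let $Q_n=\langle a,b\mid a^{2n}=1,\ b^2=a^n,\ ba=a^{-1}b\rangle$ (order $4n$), with canonical basis $\lambda(g)$ of $\mathbb{C}[Q_n]$ and $\Delta_s(\lambda(g))=\lambda(g)\otimes\lambda(g)$. For $\zeta\in\{1,-1,\mathrm{i},-\mathrm{i}\}$ let $P_\zeta=\frac14\sum_{s=0}^3\zeta^{-s}\lambda(b)^s$. Let $\Omega'=\sum_{\zeta,\eta}\omega(\zeta,\eta)P_\zeta\otimes P_\eta$ where $\omega(-1,\mathrm{i})=\omega(\mathrm{i},-\mathrm{i})=\omega(-\mathrm{i},-1)=\mathrm{i}$, $\omega(\mathrm{i},-1)=\omega(-\mathrm{i},\mathrm{i})=\omega(-1,-\mathrm{i})=-\mathrm{i}$, and $\omega=1$ otherwise. $KQ(n)$ is the $*$-algebra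 $\mathbb{C}[Q_n]$ with its usual counit and the coproduct $\Delta(x)=\Omega'\Delta_s(x)\Omega'^*$. For $k$ coprime to $2n$ (taken modulo $2n$), $\Theta_k$ is the algebra morphism with $\Theta_k(\lambda(a))=\lambda(a^k)$, $\Theta_k(\lambda(b))=\lambda(b)$. $\Theta'$ is the algebra morphism with $\Theta'(\lambda(a))=\lambda(a)-\frac12(\lambda(a)-\lambda(a^{-1}))(1+\lambda(a^n))$ and $\Theta'(\lambda(b))=\lambda(a^nb)$. *)

(* Defs.v *)
(* MathComp, with the classical sets, cardinals and real numbers of
   MathComp-Analysis. *)
From HB Require Import structures.
From mathcomp Require Import all_boot all_order all_algebra.
From mathcomp Require Import all_fingroup all_solvable ring zify.

Set Implicit Arguments.
Unset Strict Implicit.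
Unset Printing Implicit Defensive.

Import Order.TTheory GRing.Theory Num.Theory.

Local Open Scope ring_scope.

(* The group Q_n = <a, b | a^2n = 1, b^2 = a^n, ba = a^-1 b> for n >= 1: the pair
   (i, s) stands for a^i b^s; see Q_presentation. *)
Definition Qn (n : nat) : predArgType := ('Z_(2 * n) * bool)%type.

HB.instance Definition _ n := Finite.on (Qn n).

Section QnGroup.
Variable n : nat.
Implicit Types x y z : Qn n.

Definition Qmul x y : Qn n :=
  (x.1 + (if x.2 then - y.1 else y.1) + (if x.2 && y.2 then n%:R else 0),
   x.2 (+) y.2).
Definition Qone : Qn n := (0, false).
Definition Qinv x : Qn n :=
  (if x.2 then x.1 + n%:R else - x.1, x.2).

Lemma Zn2n : n%:R + n%:R = 0 :> 'Z_(2 * n).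
Proof.
rewrite -natrD addnn -mul2n; case: n => [|m]; first by rewrite muln0.
by apply: pchar_Zp; rewrite mul2n doubleS.
Qed.

Lemma ZnN : - n%:R = n%:R :> 'Z_(2 * n).
Proof. by apply/eqP; rewrite eq_sym -addr_eq0 Zn2n. Qed.

Lemma QmulA : associative Qmul.
Proof.
case=> [i [|]] [j [|]] [k [|]]; rewrite /Qmul /= ?opprD ?ZnN; congr pair; ring.
Qed.

Lemma Qmul1 : left_id Qone Qmul.
Proof. by case=> i s; rewrite /Qmul /= addr0 add0r. Qed.

Lemma QmulV : left_inverse Qone Qinv Qmul.
Proof.
case=> i [|]; rewrite /Qmul /Qinv /Qone /=; congr pair.
  by rewrite addrAC -(addrA i) Zn2n addr0 subrr.
by rewrite addr0 addNr.
Qed.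

HB.instance Definition _ := Finite_isGroup.Build (Qn n) QmulA Qmul1 QmulV.

Definition Qa : Qn n := (1, false).
Definition Qb : Qn n := (0, true).

Local Open Scope group_scope.

Lemma Q_aX k : Qa ^+ k = (k%:R, false)%R :> Qn n.
Proof.
elim: k => [//|k IHk]; rewrite expgS IHk; congr pair => /=.
by rewrite addr0 mulrS.
Qed.

Lemma Q_elt x : x = Qa ^+ x.1 * Qb ^+ x.2.
Proof.
case: x => i s; rewrite Q_aX /=; case: s => /=; congr pair => /=;
  by rewrite ?andbF !addr0 natr_Zp.
Qed.

Lemma Q_aN : Qa ^+ (2 * n) = 1.
Proof.
have e : (2 * n)%:R = 0%R :> 'Z_(2 * n) by rewrite -[RHS]Zn2n -natrD; congr (_%:R)%R; lia.
by rewrite Q_aX e.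
Qed.

Lemma Q_b2 : Qb ^+ 2 = Qa ^+ n.
Proof. by rewrite Q_aX; congr pair => /=; rewrite subrr add0r. Qed.

Lemma Q_ba : Qb * Qa = Qa^-1 * Qb.
Proof. by congr pair => /=; rewrite !addr0 add0r. Qed.

Lemma card_Q : (0 < n)%N -> #|Qn n| = (4 * n)%N.
Proof.
move=> n0; rewrite card_prod card_bool card_ord Zp_cast; first by lia.
by lia.
Qed.

Lemma Q_presentation : (0 < n)%N ->
  [set: Qn n] \isog Grp (a : b : a ^+ (2 * n), b ^+ 2 = a ^+ n,
                                 b * a = a^-1 * b).
Proof.
move=> n0; apply: intro_isoGrp => [|rT H].
  apply/existsP; exists (Qa, Qb); rewrite /= Q_aN Q_b2 Q_ba; apply/eqP.
  congr pair; apply/setP=> x; rewrite in_setT (Q_elt x).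
  by rewrite groupM // groupX // mem_gen // inE cycle_id ?orbT.
case/existsP=> -[x y] /= /eqP[defH xN y2 yx].
have xN' : x ^+ (Zp_trunc (2 * n)).+2 = 1 by rewrite Zp_cast //; lia.
have xD (i j : 'Z_(2 * n)) : x ^+ (i + j)%R = x ^+ i * x ^+ j.
  by rewrite /= expg_mod // expgD.
have xV (i : 'Z_(2 * n)) : x ^+ (- i)%R = x ^- i.
  by apply/eqP; rewrite eq_sym eq_invg_mul -xD subrr.
have xn : x ^+ (n%:R : 'Z_(2 * n))%R = y ^+ 2.
  by rewrite y2 val_Zp_nat ?expg_mod //; lia.
have yX k : y * x ^+ k = x ^- k * y.
  elim: k => [|k IHk]; first by rewrite invg1 mulg1 mul1g.
  by rewrite expgSr mulgA IHk -mulgA yx mulgA -invMg -expgS -expgSr.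
pose f (g : Qn n) := x ^+ g.1 * y ^+ g.2.
have fM : {in [set: Qn n] &, {morph f : g h / g * h}}.
  move=> [i s] [j t] _ _; rewrite [_ * _ in LHS]/(Qmul _ _) /f /Qmul.
  cbn [fst snd]; rewrite !xD.
  case: s t => [] [] /=; rewrite ?xV ?xn ?mulg1 ?mul1g -?mulgA //.
  - by rewrite !expg1 (mulgA y) yX -!mulgA.
  - by rewrite !expg1 yX.
have Hx : x \in H by rewrite -defH mem_gen // inE cycle_id.
have Hy : y \in H by rewrite -defH mem_gen // inE cycle_id orbT.
apply/homgP; exists (Morphism fM); apply/eqP; rewrite eqEsubset /=.
apply/andP; split.
  by apply/subsetP=> _ /morphimP[[i s] _ _ ->]; rewrite groupM ?groupX.
rewrite -[H : {set _}]defH join_subG !cycle_subG; apply/andP; split.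
  suff <- : f Qa = x by rewrite (mem_morphim (Morphism fM)) ?inE.
  by rewrite /f /= mulg1 Zp_cast ?expg_mod //; lia.
suff <- : f Qb = y by rewrite (mem_morphim (Morphism fM)) ?inE.
by rewrite /f /= mul1g.
Qed.
End QnGroup.

From mathcomp Require Import all_classical all_reals complex.
Local Open Scope classical_set_scope.
Local Open Scope ring_scope.

(* The group algebra R[G], with the convolution product; the coefficients of an
   element are its values. It is not the algebra of functions on G. *)
Definition galg (R : comNzRingType) (G : finGroupType) : predArgType :=
  {ffun G -> R^o}.

Section GroupAlgebra.
Variables (R : comNzRingType) (G : finGroupType).
Implicit Types x y z : galg R G.

HB.instance Definition _ := GRing.Lmodule.on (galg R G).

(* lambda(g) *)
Definition lam (g : G) : galg R G := [ffun h => (h == g)%:R].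

Definition gmul x y : galg R G :=
  [ffun g => \sum_(h : G) x h * y (h^-1 * g)%g].

Lemma galg_eq x y : (forall g, x g = y g) -> x = y.
Proof. by move=> e; apply/ffunP. Qed.

Lemma gmulA : associative gmul.
Proof.
move=> x y z; apply: galg_eq => g; rewrite !ffunE.
under eq_bigr do rewrite ffunE big_distrr /=.
rewrite [RHS](eq_bigr (fun h => \sum_k x k * y (k^-1 * h)%g * z (h^-1 * g)%g));
  last by move=> h _; rewrite ffunE big_distrl.
rewrite [RHS]exchange_big /=; apply: eq_bigr => h _.
rewrite [RHS](reindex_inj (mulgI h)) /=; apply: eq_bigr => k _.
by rewrite mulKg invMg !mulgA mulrA.
Qed.

Lemma gmul1 : left_id (lam 1%g) gmul.
Proof.
move=> x; apply: galg_eq => g; rewrite ffunE (bigD1 1%g) //= big1 ?addr0.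
  by rewrite ffunE eqxx mul1r invg1 mul1g.
by move=> h /negPf h1; rewrite ffunE h1 mul0r.
Qed.

Lemma gmulr1 : right_id (lam 1%g) gmul.
Proof.
move=> x; apply: galg_eq => g; rewrite ffunE (bigD1 g) //= big1 ?addr0.
  by rewrite ffunE mulVg eqxx mulr1.
by move=> h /negPf h1; rewrite ffunE -eq_invg_mul invgK h1 mulr0.
Qed.

Lemma gmulDl : left_distributive gmul +%R.
Proof.
move=> x y z; apply: galg_eq => g; rewrite !ffunE -big_split /=.
by apply: eq_bigr => h _; rewrite ffunE mulrDl.
Qed.

Lemma gmulDr : right_distributive gmul +%R.
Proof.
move=> x y z; apply: galg_eq => g; rewrite !ffunE -big_split /=.
by apply: eq_bigr => h _; rewrite ffunE mulrDr.
Qed.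

Lemma gmul1_neq0 : lam 1%g != 0.
Proof.
by apply/eqP => /ffunP/(_ 1%g)/eqP; rewrite !ffunE eqxx oner_eq0.
Qed.

HB.instance Definition _ := GRing.Zmodule_isNzRing.Build (galg R G)
  gmulA gmul1 gmulr1 gmulDl gmulDr gmul1_neq0.

Lemma gscaleAl (c : R) x y : c *: (x * y) = (c *: x) * y.
Proof.
apply: galg_eq => g; rewrite !ffunE scaler_sumr.
by apply: eq_bigr => h _; rewrite ffunE -scalerAl.
Qed.

HB.instance Definition _ := GRing.Lmodule_isLalgebra.Build R (galg R G) gscaleAl.

Lemma gscaleAr (c : R) x y : c *: (x * y) = x * (c *: y).
Proof.
apply: galg_eq => g; rewrite !ffunE scaler_sumr.
by apply: eq_bigr => h _; rewrite ffunE -scalerAr.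
Qed.

HB.instance Definition _ := GRing.Lalgebra_isAlgebra.Build R (galg R G) gscaleAr.

Lemma lam1 : lam 1%g = 1. Proof. by []. Qed.

Lemma lamM g h : lam (g * h)%g = lam g * lam h.
Proof.
apply: galg_eq => k; rewrite !ffunE (bigD1 g) //= big1 ?addr0.
  by rewrite !ffunE eqxx mul1r (can2_eq (mulKVg g) (mulKg g)).
by move=> l /negPf lg; rewrite ffunE lg mul0r.
Qed.

Lemma lamX g k : lam (g ^+ k)%g = lam g ^+ k.
Proof. by elim: k => [//|k IHk]; rewrite expgS exprS lamM IHk. Qed.

Lemma galg_lam x : x = \sum_g x g *: lam g.
Proof.
apply: galg_eq => g; rewrite sum_ffunE (bigD1 g) //= big1 ?addr0.
  by rewrite !ffunE eqxx; apply/esym/mulr1.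
by move=> h /negPf gh; rewrite !ffunE eq_sym gh; apply: mulr0.
Qed.
End GroupAlgebra.

Arguments lam {R G}.

(* R[G] (x) R[G] is identified with R[G * G], lam g (x) lam h being
   lam (g, h). *)
Definition gtens (R : comNzRingType) (G : finGroupType) (x y : galg R G) :
    galg R (G * G)%type :=
  [ffun p => x p.1 * y p.2].

Definition gtens_map (R : comNzRingType) (G : finGroupType)
    (f : galg R G -> galg R G) (X : galg R (G * G)%type) : galg R (G * G)%type :=
  \sum_p X p *: gtens (f (lam p.1)) (f (lam p.2)).

(* lambda(g)^* = lambda(g^-1), extended antilinearly *)
Definition gstar (C : numClosedFieldType) (G : finGroupType) (x : galg C G) :
    galg C G :=
  [ffun g => (x g^-1%g)^*].

Definition Delta_s (R : comNzRingType) (G : finGroupType) (x : galg R G) :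
    galg R (G * G)%type :=
  \sum_g x g *: gtens (lam g) (lam g).

Record kac_automorphism (C : numClosedFieldType) (G : finGroupType)
    (Delta : galg C G -> galg C (G * G)%type) (f : galg C G -> galg C G) :
    Prop := KacAutomorphism {
  kac_aut_linear : linear f;
  kac_aut_mul : {morph f : x y / x * y};
  kac_aut_one : f 1 = 1;
  kac_aut_star : {morph f : x / gstar x};
  kac_aut_bij : bijective f;
  kac_aut_comul : forall x, Delta (f x) = gtens_map f (Delta x)
}.

Definition KQ (C : numClosedFieldType) (n : nat) : Type := galg C (Qn n).

Section KQ.
Variables (C : numClosedFieldType) (n : nat).
Local Notation K := (galg C (Qn n)).
Local Notation a := (Qa n).
Local Notation b := (Qb n).

Definition P (z : C) : K := 4^-1 *: \sum_(s < 4) z ^- s *: lam b ^+ s.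

Definition omega (z e : C) : C :=
  if (z, e) \in [:: (-1, 'i); ('i, - 'i); (- 'i, -1)] then 'i
  else if (z, e) \in [:: ('i, -1); (- 'i, 'i); (-1, - 'i)] then - 'i
  else 1.

Definition Omega' : galg C (Qn n * Qn n)%type :=
  \sum_(z <- [:: 1; -1; 'i; - 'i]) \sum_(e <- [:: 1; -1; 'i; - 'i])
    omega z e *: gtens (P z) (P e).

Definition Delta (x : K) : galg C (Qn n * Qn n)%type :=
  Omega' * Delta_s x * gstar Omega'.

Definition Aut_KQ : set (KQ C n -> KQ C n) := [set f | kac_automorphism Delta f].

(* The linear map with a^i b^s |-> u^i v^s: it is the algebra morphism with
   a |-> u and b |-> v as soon as u and v satisfy the relations of Q_n. *)
Definition qext (u v : K) (x : K) : K :=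
  \sum_(g : Qn n) x g *: (u ^+ g.1 * v ^+ g.2).

Lemma qext_is_linear u v : linear (qext u v).
Proof.
move=> c x y; rewrite /qext scaler_sumr -big_split /=.
by apply: eq_bigr => g _; rewrite !ffunE scalerA scalerDl.
Qed.

HB.instance Definition _ u v :=
  GRing.isLinear.Build C K K *:%R (qext u v) (qext_is_linear u v).

Lemma qext_lam u v (g : Qn n) : qext u v (lam g) = u ^+ g.1 * v ^+ g.2.
Proof.
rewrite /qext (bigD1 g) //= big1 ?addr0; first by rewrite ffunE eqxx scale1r.
by move=> h /negPf hg; rewrite ffunE hg scale0r.
Qed.

Lemma qext_a u v : qext u v (lam a) = u.
Proof. by rewrite qext_lam /= expr0 mulr1 modn_small ?expr1. Qed.

Lemma qext_b u v : qext u v (lam b) = v.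
Proof. by rewrite qext_lam /= expr0 mul1r expr1. Qed.

Lemma qext1 u v : qext u v 1 = 1.
Proof. by rewrite -lam1 qext_lam /= !expr0 mulr1. Qed.

Lemma qext_mul u v : (0 < n)%N ->
  u ^+ (2 * n) = 1 -> v ^+ 2 = u ^+ n -> u * v * u = v ->
  {morph qext u v : x y / x * y}.
Proof.
move=> n0 uN v2 uvu.
have uN' : u ^+ (Zp_trunc (2 * n)).+2 = 1 by rewrite Zp_cast //; lia.
have uD (i j : 'Z_(2 * n)) : u ^+ (i + j)%R = u ^+ i * u ^+ j.
  by rewrite /= (expr_mod _ uN') exprD.
have un : u ^+ (n%:R : 'Z_(2 * n))%R = v ^+ 2.
  by rewrite v2 val_Zp_nat ?expr_mod //; lia.
have uvX k : u ^+ k * v * u ^+ k = v.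
  elim: k => [|k IHk]; first by rewrite !expr0 mulr1 mul1r.
  by rewrite {1}exprSr exprS !mulrA -(mulrA _ u v) -(mulrA _ _ u) uvu IHk.
have vX (i : 'Z_(2 * n)) : v * u ^+ i = u ^+ (- i)%R * v.
  by rewrite -{2}(uvX i) !mulrA -uD addNr expr0 mul1r.
have lamE (g h : Qn n) :
    qext u v (lam g * lam h) = qext u v (lam g) * qext u v (lam h).
  rewrite -lamM !qext_lam; case: g h => [i s] [j t].
  rewrite [(_ * _)%g in LHS]/(Qmul _ _) /Qmul; cbn [fst snd]; rewrite !uD.
  case: s t => [] [] /=; rewrite ?un ?expr0 ?expr1 ?mulr1 ?mul1r ?mulrA //.
  - by rewrite -(mulrA _ v (u ^+ j)) vX !mulrA.
  - by rewrite -(mulrA _ v (u ^+ j)) vX !mulrA.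
move=> x y; rewrite (galg_lam x) (galg_lam y) mulr_suml !linear_sum mulr_suml.
apply: eq_bigr => g _; rewrite mulr_sumr !linear_sum mulr_sumr.
apply: eq_bigr => h _.
by rewrite -scalerAl -scalerAr !linearZ /= lamE -scalerAl -scalerAr.
Qed.

Lemma qext_unique (f : {lrmorphism K -> K}) :
  f =1 qext (f (lam a)) (f (lam b)).
Proof.
move=> x; rewrite {1}(galg_lam x) linear_sum; apply: eq_bigr => g _.
rewrite linearZ /=; congr (_ *: _).
by rewrite {1}(Q_elt g) lamM !lamX rmorphM !rmorphXn.
Qed.

Definition Theta (k : nat) : K -> K := qext (lam (a ^+ k)%g) (lam b).

Lemma Theta_mul k : (0 < n)%N -> odd k -> {morph Theta k : x y / x * y}.
Proof.
move=> n0 ok; apply: qext_mul => //.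
- by rewrite -!lamX -expgM mulnC expgM Q_aN expg1n.
- rewrite -!lamX Q_b2 -expgM mulnC -(odd_double_half k) ok mulnDr muln1.
  by rewrite -mul2n mulnCA mulnA expgD expgM Q_aN expg1n mulg1.
rewrite -!lamM; congr lam; elim: k {ok} => [|k IHk].
  by rewrite expg0 mul1g mulg1.
by rewrite {1}expgSr expgS !mulgA -(mulgA _ b a) Q_ba mulgA mulgK.
Qed.

Definition Theta'_a : K :=
  lam a - 2^-1 *: ((lam a - lam a^-1%g) * (1 + lam (a ^+ n)%g)).
Definition Theta' : K -> K := qext Theta'_a (lam (a ^+ n * b)%g).

Lemma Theta'_mul : (0 < n)%N -> {morph Theta' : x y / x * y}.
Proof.
move=> n0; set A : K := lam a; set B : K := lam a^-1%g.
set z : K := lam (a ^+ n)%g; set V : K := lam (a ^+ n * b)%g.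
pose e : K := 2^-1 *: (1 + z); pose f := 1 - e.
have AB : A * B = 1 by rewrite -lamM mulgV.
have BA : B * A = 1 by rewrite -lamM mulVg.
have anV : (a ^- n = a ^+ n)%g.
  by apply/eqP; rewrite eq_invg_mul -expgD addnn -mul2n Q_aN.
have zz : z * z = 1 by rewrite -lamM -expgD addnn -mul2n Q_aN.
have zA : z * A = A * z by rewrite -!lamM -expgS -expgSr.
have zB : z * B = B * z.
  by rewrite -[LHS]mul1r -{1}BA -mulrA (mulrA A) -zA -!mulrA AB mulr1.
have baX k : (b * a ^+ k = a ^- k * b)%g.
  elim: k => [|k IHk]; first by rewrite invg1 mulg1 mul1g.
  by rewrite expgSr mulgA IHk -mulgA Q_ba mulgA -invMg -expgS -expgSr.
have zV : z * V = V * z.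
  by rewrite -!lamM -!mulgA baX anV.
have VA : V * A = B * V.
  rewrite -!lamM -mulgA Q_ba !mulgA; congr (lam (_ * _)%g).
  by apply/commute_sym/commuteX/commute_sym/commuteV.
have VB : V * B = A * V.
  by rewrite -[LHS]mul1r -{1}AB -!mulrA (mulrA B) -VA -!mulrA AB mulr1.
have ee : e * e = e.
  rewrite /e -scalerAl -scalerAr mulrDl mul1r mulrDr mulr1 zz (addrC z).
  rewrite -mulr2n -scaler_nat !scalerA; congr (_ *: _).
  by rewrite -mulrA mulVf ?mulr1 // pnatr_eq0.
have ec x : z * x = x * z -> e * x = x * e.
  by move=> zx; rewrite /e -scalerAl -scalerAr mulrDl mulrDr mul1r mulr1 zx.
have fc x : z * x = x * z -> f * x = x * f.
  by move=> zx; rewrite /f mulrBl mulrBr mul1r mulr1 ec.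
have ef : e * f = 0 by rewrite /f mulrBr mulr1 ee subrr.
have fe : f * e = 0 by rewrite /f mulrBl mul1r ee subrr.
have ff : f * f = f by rewrite {1}/f mulrBl mul1r ef subr0.
have f1 : f + e = 1 by rewrite /f subrK.
have UE : Theta'_a = A * f + B * e.
  rewrite /Theta'_a -/A -/B -/z scalerAr -/e /f mulrBr mulr1 mulrBl.
  by rewrite opprB addrA [in RHS]addrAC.
clearbody f; clearbody e.
have comb (x y x' y' : K) : z * x' = x' * z -> z * y' = y' * z ->
    (x * f + y * e) * (x' * f + y' * e) = x * x' * f + y * y' * e.
  move=> zx zy.
  have sw (s t p q : K) : p * t = t * p -> s * p * (t * q) = s * t * (p * q).
    by move=> pt; rewrite -!mulrA (mulrA p) pt -!mulrA.
  have [fx fy ex ey] := And4 (fc _ zx) (fc _ zy) (ec _ zx) (ec _ zy).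
  rewrite mulrDl !mulrDr (sw _ _ _ _ fx) (sw _ _ _ _ fy) (sw _ _ _ _ ex).
  rewrite (sw _ _ _ _ ey).
  by rewrite ff ee ef fe !mulr0 addr0 add0r.
have zX x k : z * x = x * z -> z * x ^+ k = x ^+ k * z.
  by move=> zx; apply/commrX.
have UX k : Theta'_a ^+ k = A ^+ k * f + B ^+ k * e.
  elim: k => [|k IHk]; first by rewrite !expr0 !mul1r f1.
  by rewrite exprS IHk UE comb ?zX // !exprS.
apply: qext_mul => //.
- rewrite UX -!lamX expgVn Q_aN invg1 lam1 !mul1r; exact: f1.
- rewrite UX -!lamX expgVn anV -mulrDr f1 mulr1.
  rewrite expgS expg1 -!mulgA (mulgA b) baX anV -!mulgA.
  by rewrite (mulgA (a ^+ n)%g) -expgD addnn -mul2n Q_aN mul1g -Q_b2.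
- rewrite UE -mulrA mulrDr !mulrA VA VB -!mulrA -(fc V) // -(ec V) // !mulrA.
  by rewrite -mulrDl mulrA comb // AB BA !mul1r f1 mul1r.
Qed.

Definition A2n : set (KQ C n -> KQ C n) :=
  [set f | exists2 k, coprime k (2 * n) &
             f = Theta k \/ f = Theta k \o Theta'].
End KQ.

Arguments Aut_KQ C n : clear implicits.
Arguments A2n C n : clear implicits.

(* Main.v *)
Require Import Defs.
From HB Require Import structures.
From mathcomp Require Import all_boot all_order all_algebra.
From mathcomp Require Import all_fingroup all_solvable.
From mathcomp Require Import all_classical all_reals complex.
From mathcomp Require Import ring zify.

(** The twisted coproduct becomes elementary once [C[Q_n]] is cut by the central
    group-like element [z = b^2 = a^n] into the ideals [e K] and [m K], where
    [e = (1 + z) / 2] ([ep] below) and [m = 1 - e] ([em]).  The twist [Omega'] acts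
    as the identity on [e (x) e], and on [m (x) m] it is a pure tensor
    [v (x) v^*], with [v = P_i - i P_{-i}] ([vtw]) a unitary of [m K] such that
    [v^2 = - i b m].  Hence
    - [(e (x) e) Delta] is the coproduct of the group algebra of the dihedral
      group [Q_n / z];
    - [(m (x) m) Delta(g) = (v g v^* ) (x) (v^* g v)] for [g] in [Q_n], and the
      block [(m (x) m) Delta(x)] depends on [x e] alone.

    Every automorphism [f] fixes [z].  Indeed [f z] is central and group-like,
    so its [e] part is some [h e] with [h] in [Q_n] ([grouplike_ep]), and its
    [m] part is proportional to [v h v^*]; thus [h m] is central, [h] is central
    in [Q_n], and [f z] is [1] or [z] ([aut_fix_z]).

    So [f] preserves [e] and [m], and it induces on [e K] an automorphism of
    [Q_n / z]: to each [g] there correspond [h] in [Q_n] and a scalar [c] with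
    [f(g) e = h e], [v h v^* = c f(v g v^* )] and [f(v^* g v) = c v^* h v]
    ([aut_lam]).  For [g = b], where [v] commutes with [g], comparing squares
    gives [c^2 = 1]; hence [v h v^* = v^* h v], so that [h] commutes with
    [v^2 = - i b m], and this leaves only [f(b) = b] or [f(b) = b^-1]
    ([aut_b]).  The assumption [n >= 3] ensures that [h] is a reflection here,
    and a rotation for [g = a].  If [f(b) = b] then [f] fixes [v], and the
    same two equations for [g = a] show that [f(a)] is a power of [a]: thus
    [f = Theta_k] ([aut_Theta]).  If [f(b) = b^-1], the previous case applies
    to [f Theta'].

    Conversely [Theta_k] fixes [b], hence [Omega'], and is induced by an
    automorphism of [Q_n].  The map [Theta'] inverts [b], hence maps [Omega'] to
    [Omega'^*], so its compatibility with [Delta] on [a] amounts to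
    [Omega'^2 Delta_s(u) = (u (x) u) Omega'^2] for [u = Theta'(a) = a m + a^-1 e]
    ([Omega'2_twist]); it is checked on the four blocks cut out by [e] and [m].

    Finally [Theta'] is an involution commuting with all the [Theta_k], so the
    semidirect product can be taken for the trivial action, and
    [(s, k) |-> Theta_k Theta'^s] is the isomorphism onto the automorphism group.
    Its injectivity also gives the order. *)

Set Implicit Arguments.
Unset Strict Implicit.
Unset Printing Implicit Defensive.

Import GRing.Theory Num.Theory.
Local Open Scope classical_set_scope.
Local Open Scope ring_scope.

(** * Tensors and the involution of a group algebra *)

Section Tensors.
Variables (R : comNzRingType) (G : finGroupType).
Implicit Types (x y : galg R G) (g h : G).
Local Notation A := (galg R G).
Local Notation A2 := (galg R (G * G)%type).

Lemma galg_linear_eq (V : lmodType R) (f1 f2 : {linear A -> V}) :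
  (forall g, f1 (lam g) = f2 (lam g)) -> f1 =1 f2.
Proof.
move=> e x; rewrite (galg_lam x) !linear_sum; apply: eq_bigr => g _.
by rewrite !linearZ /= e.
Qed.

(** The tensor product with its arguments swapped, which carries the linearity
    in the first argument. *)
Definition gtensr y x : A2 := gtens x y.

Lemma gtens_is_linear_l y : linear (gtensr y).
Proof. by move=> c x x'; apply/ffunP=> p; rewrite !ffunE mulrDl scalerAl. Qed.

Lemma gtens_is_linear_r x : linear (gtens x : A -> A2).
Proof. by move=> c y y'; apply/ffunP=> p; rewrite !ffunE mulrDr scalerAr. Qed.

HB.instance Definition _ x :=
  GRing.isLinear.Build R A A2 *:%R (gtens x) (gtens_is_linear_r x).

HB.instance Definition _ y :=
  GRing.isLinear.Build R A A2 *:%R (gtensr y) (gtens_is_linear_l y).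

Lemma gtensDl x x' y : gtens (x + x') y = gtens x y + gtens x' y.
Proof. exact: (linearD (gtensr y)). Qed.

Lemma gtensDr x y y' : gtens x (y + y') = gtens x y + gtens x y'.
Proof. exact: linearD. Qed.

Lemma gtensZl c x y : gtens (c *: x) y = c *: gtens x y.
Proof. exact: (linearZ_LR (gtensr y)). Qed.

Lemma gtensZr c x y : gtens x (c *: y) = c *: gtens x y.
Proof. exact: linearZ_LR. Qed.

Lemma gtens_suml (I : Type) (r : seq I) (F : I -> A) y :
  gtens (\sum_(i <- r) F i) y = \sum_(i <- r) gtens (F i) y.
Proof. exact: (linear_sum (gtensr y)). Qed.

Lemma gtens_sumr (I : Type) (r : seq I) (F : I -> A) x :
  gtens x (\sum_(i <- r) F i) = \sum_(i <- r) gtens x (F i).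
Proof. exact: linear_sum. Qed.

Lemma gtens_lam g h : gtens (lam g) (lam h) = lam (g, h) :> A2.
Proof.
by apply/ffunP=> p; rewrite !ffunE -natrM mulnb -xpair_eqE -surjective_pairing.
Qed.

Lemma gtens1 : gtens 1 1 = 1 :> A2.
Proof. exact: gtens_lam. Qed.

Lemma gtensM x y x' y' :
  gtens x y * gtens x' y' = gtens (x * x') (y * y') :> A2.
Proof.
apply/ffunP=> p; rewrite !ffunE big_distrlr /= pair_big /=.
by apply: eq_bigr => q _; rewrite !ffunE mulrACA.
Qed.

Lemma lam_inj : injective (@lam R G).
Proof.
move=> g h /ffunP/(_ g)/eqP; rewrite !ffunE eqxx; have [//|_] := eqVneq g h.
by rewrite oner_eq0.
Qed.

Lemma gtens_map_is_linear (f : {linear A -> A}) : linear (gtens_map f : A2 -> A2).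
Proof.
move=> c X Y; rewrite /gtens_map scaler_sumr -big_split /=.
by apply: eq_bigr => p _; rewrite !ffunE scalerA scalerDl.
Qed.

HB.instance Definition _ (f : {linear A -> A}) :=
  GRing.isLinear.Build R A2 A2 *:%R (gtens_map f) (gtens_map_is_linear f).

Lemma gtens_map_lam (f : {linear A -> A}) p :
  gtens_map f (lam p) = gtens (f (lam p.1)) (f (lam p.2)).
Proof.
rewrite /gtens_map (bigD1 p) //= big1 ?addr0; first by rewrite ffunE eqxx scale1r.
by move=> q /negPf pq; rewrite ffunE pq scale0r.
Qed.

Lemma gtens_mapE (f : {linear A -> A}) x y :
  gtens_map f (gtens x y) = gtens (f x) (f y).
Proof.
rewrite {1}(galg_lam x) gtens_suml linear_sum /=.
rewrite {2}(galg_lam x) linear_sum gtens_suml; apply: eq_bigr => g _.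
rewrite gtensZl !linearZ /= gtensZl; congr (_ *: _).
rewrite {1}(galg_lam y) {2}(galg_lam y) !linear_sum; apply: eq_bigr => h _.
by rewrite !linearZ /= gtens_lam gtens_map_lam.
Qed.

(** Both sides are bilinear. *)
Lemma galg_mul_lam (H : finGroupType) (B : algType R)
    (f : {linear galg R H -> B}) :
  (forall g h : H, f (lam g * lam h) = f (lam g) * f (lam h)) ->
  {morph f : x y / x * y}.
Proof.
move=> fM x y; rewrite (galg_lam x) (galg_lam y) mulr_suml !linear_sum mulr_suml.
apply: eq_bigr => g _; rewrite mulr_sumr !linear_sum mulr_sumr.
apply: eq_bigr => h _.
by rewrite -scalerAl -scalerAr !linearZ /= fM -scalerAl -scalerAr.
Qed.

Lemma gtens_mapM (f : {lrmorphism A -> A}) :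
  {morph (gtens_map f : A2 -> A2) : X Y / X * Y}.
Proof.
apply: galg_mul_lam => -[g h] [g' h'] /=; rewrite -lamM !gtens_map_lam /=.
by rewrite gtensM -!rmorphM -!lamM.
Qed.

Lemma Delta_s_is_linear : linear (@Delta_s R G).
Proof.
move=> c x y; rewrite /Delta_s scaler_sumr -big_split /=.
by apply: eq_bigr => g _; rewrite !ffunE scalerA scalerDl.
Qed.

HB.instance Definition _ :=
  GRing.isLinear.Build R A A2 *:%R (@Delta_s R G) Delta_s_is_linear.

Lemma Delta_s_lam g : Delta_s (lam g) = gtens (lam g) (lam g) :> A2.
Proof.
rewrite /Delta_s (bigD1 g) //= big1 ?addr0; first by rewrite ffunE eqxx scale1r.
by move=> h /negPf hg; rewrite ffunE hg scale0r.
Qed.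

Lemma Delta_sM : {morph (@Delta_s R G) : x y / x * y}.
Proof. by apply: galg_mul_lam => g h /=; rewrite -lamM !Delta_s_lam gtensM lamM. Qed.

End Tensors.

Section Star.
Variables (C : numClosedFieldType) (G : finGroupType).
Implicit Types (x y : galg C G) (g h : G).

Lemma gstarD x y : gstar (x + y) = gstar x + gstar y.
Proof. by apply/ffunP=> g; rewrite !ffunE rmorphD. Qed.

Lemma gstarZ c x : gstar (c *: x) = c^* *: gstar x.
Proof. by apply/ffunP=> g; rewrite !ffunE; apply: rmorphM. Qed.

Lemma gstar_sum (I : Type) (r : seq I) (F : I -> galg C G) :
  gstar (\sum_(i <- r) F i) = \sum_(i <- r) gstar (F i).
Proof.
have gstar0 : gstar 0 = 0 :> galg C G.
  by apply/ffunP=> g; rewrite !ffunE; apply: rmorph0.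
exact: (big_morph _ gstarD gstar0).
Qed.

Lemma gstar_lam g : gstar (lam g) = lam g^-1%g :> galg C G.
Proof.
by apply/ffunP=> h; rewrite !ffunE conjC_nat (can2_eq invgK invgK).
Qed.

Lemma gstarM x y : gstar (x * y) = gstar y * gstar x.
Proof.
rewrite (galg_lam x) (galg_lam y) mulr_suml !gstar_sum mulr_sumr.
apply: eq_bigr => g _; rewrite mulr_sumr gstar_sum mulr_suml.
apply: eq_bigr => h _; rewrite -scalerAl -scalerAr !gstarZ -scalerAl -scalerAr.
by rewrite -lamM !gstar_lam invMg lamM scalerA [RHS]scalerA mulrC.
Qed.

Lemma gstarK : involutive (@gstar C G).
Proof. by move=> x; apply/ffunP=> g; rewrite !ffunE invgK conjCK. Qed.

Lemma gstar_gtens x y : gstar (gtens x y) = gtens (gstar x) (gstar y).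
Proof. by apply/ffunP=> p; rewrite !ffunE rmorphM. Qed.

Lemma galg_neq0 x : x != 0 -> exists g, x g != 0.
Proof.
move=> x0; apply/existsP; apply: contraNT x0; rewrite negb_exists => /forallP k.
by apply/eqP/ffunP=> h; rewrite [RHS]ffunE; apply/eqP/negPn/k.
Qed.

(** A scalar can move across a tensor sign, and this is the only ambiguity in
    the factors of a nonzero pure tensor. *)
Lemma gtens_eq x y x' y' : x != 0 -> y' != 0 ->
  gtens x y = gtens x' y' -> exists c, x' = c *: x /\ y = c *: y'.
Proof.
move=> x0 y'0 /ffunP e.
have E g h : x g * y h = x' g * y' h by have := e (g, h); rewrite !ffunE.
have [h yh] := galg_neq0 y'0; have [g xg] := galg_neq0 x0.
have X k : x' k = y h / y' h * x k.
  by apply: (mulIf yh); rewrite -E mulrAC divfK // mulrC.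
exists (y h / y' h); split; apply/ffunP=> k; rewrite ffunE; first exact: X.
change (y k = y h / y' h * y' k).
by apply: (mulfI xg); rewrite E X -mulrA mulrCA.
Qed.

End Star.

(** * Spectral projections of an element of order four *)

Section FourthRoots.
Variable C : numClosedFieldType.

Definition roots4 : seq C := [:: 1; -1; 'i; - 'i].

Lemma neq_1N1 : (1 == -1 :> C) = false.
Proof. by rewrite -addr_eq0 -mulr2n pnatr_eq0. Qed.

Lemma neq_i1 : ('i == 1 :> C) = false.
Proof.
apply/negP=> /eqP/(congr1 (fun z => z ^+ 2)); rewrite sqrCi expr1n => /eqP.
by rewrite eq_sym neq_1N1.
Qed.

Lemma neq_iN1 : ('i == -1 :> C) = false.
Proof.
apply/negP=> /eqP/(congr1 (fun z => z ^+ 2)); rewrite sqrCi sqrrN expr1n => /eqP.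
by rewrite eq_sym neq_1N1.
Qed.

Lemma neq_iNi : ('i == - 'i :> C) = false.
Proof. by rewrite -addr_eq0 -mulr2n mulrn_eq0 /= (negbTE (neq0Ci C)). Qed.

Lemma neq_N1Ni : (-1 == - 'i :> C) = false.
Proof. by rewrite eqr_opp eq_sym neq_i1. Qed.

Lemma neq_1Ni : (1 == - 'i :> C) = false.
Proof. by rewrite -eqr_oppLR eq_sym neq_iN1. Qed.

Definition roots4_neq :=
  (eqxx, neq_1N1, neq_i1, neq_iN1, neq_iNi, neq_N1Ni, neq_1Ni,
   (etrans (eq_sym _ _) neq_1N1, etrans (eq_sym _ _) neq_i1,
    etrans (eq_sym _ _) neq_iN1, etrans (eq_sym _ _) neq_iNi,
    etrans (eq_sym _ _) neq_N1Ni, etrans (eq_sym _ _) neq_1Ni)).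

Lemma roots4_uniq : uniq roots4.
Proof. by rewrite /= !inE !negb_or !roots4_neq. Qed.

Lemma omegaE : ((omega 1 1 = 1 :> C) * (omega 1 (-1) = 1 :> C)
 * (omega 1 'i = 1 :> C) * (omega 1 (- 'i) = 1 :> C)
 * (omega (-1) 1 = 1 :> C) * (omega (-1) (-1) = 1 :> C)
 * (omega (-1) 'i = 'i :> C) * (omega (-1) (- 'i) = - 'i :> C))
 * ((omega 'i 1 = 1 :> C) * (omega 'i (-1) = - 'i :> C)
 * (omega 'i 'i = 1 :> C) * (omega 'i (- 'i) = 'i :> C)
 * (omega (- 'i) 1 = 1 :> C) * (omega (- 'i) (-1) = 'i :> C)
 * (omega (- 'i) 'i = - 'i :> C) * (omega (- 'i) (- 'i) = 1 :> C)).
Proof. by rewrite /omega !inE !xpair_eqE !roots4_neq. Qed.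

Lemma conjC_roots4 : ((1^* = 1 :> C) * ((-1)^* = -1 :> C))
  * (('i^* = - 'i :> C) * ((- 'i)^* = 'i :> C)).
Proof. by rewrite !rmorphN /= conjC1 conjCi opprK. Qed.

Lemma roots4X z : z \in roots4 -> z ^+ 4 = 1.
Proof. by rewrite !inE => /or4P[] /eqP->; ring: (sqrCi C). Qed.

Lemma roots4_neq0 z : z \in roots4 -> z != 0.
Proof.
move=> /roots4X z4; apply/eqP=> z0; move: z4; rewrite z0 expr0n => /esym/eqP.
by rewrite oner_eq0.
Qed.

Lemma roots4_conj z : z \in roots4 -> z^* \in roots4.
Proof.
by rewrite !inE => /or4P[] /eqP->; rewrite !conjC_roots4 eqxx ?orbT.
Qed.

Lemma roots4_conjM z : z \in roots4 -> z^* * z = 1.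
Proof.
by rewrite !inE => /or4P[] /eqP->; rewrite !conjC_roots4; ring: (sqrCi C).
Qed.

Lemma sum_roots4_conj (V : zmodType) (G : C -> V) :
  \sum_(z <- roots4) G z^* = \sum_(z <- roots4) G z.
Proof.
by rewrite !big_cons !big_nil !conjC_roots4 !addr0 (addrC (G (- 'i))).
Qed.

Variables (A : algType C) (beta : A).
Hypothesis beta4 : beta ^+ 4 = 1.

Definition eigenproj (z : C) : A := 4^-1 *: \sum_(s < 4) z ^- s *: beta ^+ s.

Lemma eigenprojE z : z \in roots4 -> eigenproj z =
  4^-1 *: (1 + z ^+ 3 *: beta + z ^+ 2 *: beta ^+ 2 + z *: beta ^+ 3).
Proof.
move=> zr; have zV k : (k <= 4)%N -> z ^- k = z ^+ (4 - k).
  move=> k4; apply/(mulIf (expf_neq0 k (roots4_neq0 zr))).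
  by rewrite -exprD subnK // roots4X // mulVf // expf_neq0 // roots4_neq0.
rewrite /eigenproj !big_ord_recl big_ord0 /= addr0 !addrA !zV //= expr0 expr1.
by rewrite roots4X // scale1r.
Qed.

Lemma eigenproj_eigen z : z \in roots4 -> eigenproj z * beta = z *: eigenproj z.
Proof.
move=> zr; rewrite eigenprojE // -scalerAl [RHS]scalerA (mulrC z) -[RHS]scalerA.
congr (_ *: _); rewrite !mulrDl mul1r -!scalerAl -expr2 -!exprSr beta4.
rewrite !scalerDr !scalerA -!exprS -expr2 roots4X // scale1r.
by rewrite [LHS]addrC !addrA.
Qed.

Lemma eigen_expr x z k : x * beta = z *: x -> x * beta ^+ k = z ^+ k *: x.
Proof.
move=> e; elim: k => [|k IHk]; first by rewrite !expr0 mulr1 scale1r.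
by rewrite exprS mulrA e -scalerAl IHk scalerA -exprS.
Qed.

(** Writing [z = t w], the coefficient is the mean of the powers of the fourth root
    of unity [w]. *)
Lemma eigen_eigenproj x z t : z \in roots4 -> t \in roots4 ->
  x * beta = z *: x -> x * eigenproj t = (z == t)%:R *: x.
Proof.
move=> zr tr /eigen_expr xX; rewrite eigenprojE // -scalerAr !mulrDr -!scalerAr.
rewrite !xX mulr1 -[beta]expr1 xX expr1 !scalerA -{1}[x]scale1r -!scalerDl scalerA.
congr (_ *: _); move: zr tr; rewrite !inE => /or4P[] /eqP-> /or4P[] /eqP->.
all: by rewrite ?roots4_neq /=; field: (sqrCi C).
Qed.

Lemma sum_eigenproj : \sum_(z <- roots4) eigenproj z = 1.
Proof.
have sumX k : (0 < k < 4)%N -> \sum_(z <- roots4) z ^+ k = 0.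
  by case: k => [|[|[|[|k]]]] // _; rewrite !big_cons big_nil; ring: (sqrCi C).
rewrite (eq_big_seq _ eigenprojE) -scaler_sumr !big_split /= -!scaler_suml.
rewrite !sumX // (eq_bigr (fun z : C => z ^+ 1)) // sumX // !scale0r !addr0.
by rewrite !big_cons big_nil addr0 -[1 + _]/(4%:R : A) -scaler_nat scalerA mulVf
  ?scale1r // pnatr_eq0.
Qed.

End FourthRoots.

(** * The ideals of the group algebra cut out by b^2 *)

Section Quaternion.
Variables (C : numClosedFieldType) (n : nat).
Hypothesis n0 : (0 < n)%N.
Local Notation K := (galg C (Qn n)).
Local Notation K2 := (galg C (Qn n * Qn n)%type).
Local Notation a := (Qa n).
Local Notation b := (Qb n).
Local Notation zq := (Qa n ^+ n)%g.
Implicit Types (x y : K) (g h : Qn n).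

Lemma zqE : zq = (n%:R, false) :> Qn n.
Proof. exact: Q_aX. Qed.

Lemma zq_central g : (zq * g = g * zq)%g.
Proof.
by rewrite zqE; case: g => i [] /=; congr pair; rewrite /= ?addr0 ?ZnN // addrC.
Qed.

Lemma zqK : (zq * zq = 1)%g.
Proof. by rewrite -expgD addnn -mul2n Q_aN. Qed.

Lemma Zn_neq0 : n%:R != 0 :> 'Z_(2 * n).
Proof.
apply/eqP=> /(congr1 val) /=.
by rewrite val_Zp_nat ?modn_small //; lia.
Qed.

Lemma zq_neq1 : zq != 1%g.
Proof. by rewrite zqE xpair_eqE negb_and Zn_neq0. Qed.

Lemma Qb_sqr : (b * b = zq)%g.
Proof. exact: Q_b2. Qed.

Lemma QbV : (b^-1 = zq * b)%g.
Proof. by apply/eqP; rewrite eq_invg_mul mulgA -zq_central -mulgA Qb_sqr zqK. Qed.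

Lemma zqV : (zq^-1 = zq)%g.
Proof. by apply/eqP; rewrite eq_invg_mul zqK. Qed.

Lemma baV : (b * a^-1 = a * b)%g.
Proof. by apply: (mulIg a); rewrite mulgKV -mulgA Q_ba mulKVg. Qed.

Lemma Zp_half (i : 'Z_(2 * n)) : i + i = 0 -> i = 0 \/ i = n%:R.
Proof.
have n2 : (Zp_trunc (2 * n)).+2 = (2 * n)%N by rewrite Zp_cast //; lia.
have e k : ((k + k) %% (Zp_trunc (2 * n)).+2 = (k + k) %% (2 * n))%N by rewrite n2.
move=> /(congr1 val) /=; rewrite e => /eqP ii.
have i2 : (i < 2 * n)%N by apply: leq_trans (ltn_ord i) _; rewrite n2.
have [i0|i0] : i = 0%N :> nat \/ i = n :> nat.
  move: (nat_of_ord i) ii i2 => j; rewrite -[_ == _]/(2 * n %| j + j)%N.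
  by case/dvdnP => [[|[|k]]]; rewrite ?mulSn => jj j2; lia.
- by left; apply: val_inj.
- by right; apply: val_inj; rewrite /= val_Zp_nat ?modn_small; lia.
Qed.

Lemma natr_Zp_eq0 k : (k%:R == 0 :> 'Z_(2 * n)) = (2 * n %| k)%N.
Proof. by rewrite -val_eqE /= val_Zp_nat //; lia. Qed.

(** A reflection would conjugate [a] to [a^-1], which is not [a] since [2 n > 2]. *)
Lemma commute_a h : (3 <= n)%N -> (h * a = a * h)%g -> h.2 = false.
Proof.
case: h => i [] // n3 /(congr1 fst); rewrite /= !addr0 addrC => /addIr/eqP.
rewrite eq_sym -addr_eq0 -[1 + 1]/(2%:R) natr_Zp_eq0 => /dvdn_leq; lia.
Qed.

(** The rotation part of [h] must be equal to its inverse. *)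
Lemma commute_b h : (h * b = b * h)%g -> h.1 = 0 \/ h.1 = n%:R.
Proof.
case: h => i s e.
have {e} : i + (if s then n%:R else 0) = - i + (if s then n%:R else 0) :> 'Z_(2 * n).
  by case: s e => /(congr1 fst) /=; rewrite ?oppr0 ?addr0 ?add0r ?addr0.
by move=> /addIr/eqP; rewrite -addr_eq0 => /eqP; apply: Zp_half.
Qed.

Lemma Qsqr h : h.2 -> (h * h = zq)%g.
Proof. by case: h => i [] // _; rewrite zqE; congr pair; rewrite /= subrr add0r. Qed.

Lemma Qrot_commute g h : g.2 = false -> h.2 = false -> (g * h = h * g)%g.
Proof.
by case: g h => i [] // [j []] // _ _; congr pair; rewrite /= !addr0 addrC.
Qed.

(** [ep] and [em] are the central idempotents on which [b^2 = a^n] acts as [1] and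
    as [-1]; [ep K] is the group algebra of the dihedral group of order [2 n]. *)
Definition ep : K := 2^-1 *: (1 + lam zq).
Definition em : K := 1 - ep.

Lemma epDem : ep + em = 1.
Proof. by rewrite addrC subrK. Qed.

Lemma emE : em = 2^-1 *: (1 - lam zq).
Proof.
rewrite /em /ep -{1}[1](scale1r (1 : K)) !scalerDr scalerN opprD addrA -scalerBl.
by congr (_ *: _ - _); field.
Qed.

Lemma zq_ep : lam zq * ep = ep.
Proof. by rewrite /ep -scalerAr mulrDr mulr1 -lamM zqK addrC. Qed.

Lemma zq_em : lam zq * em = - em.
Proof. by rewrite emE -scalerAr mulrBr mulr1 -lamM zqK -scalerN opprB. Qed.

Lemma ep_id : ep * ep = ep.
Proof.
by rewrite {1}/ep -scalerAl mulrDl mul1r zq_ep -mulr2n -scaler_nat scalerA mulVf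
  ?scale1r // pnatr_eq0.
Qed.

Lemma ep_em : ep * em = 0.
Proof. by rewrite /em mulrBr mulr1 ep_id subrr. Qed.

Lemma em_ep : em * ep = 0.
Proof. by rewrite /em mulrBl mul1r ep_id subrr. Qed.

Lemma em_id : em * em = em.
Proof. by rewrite {2}/em mulrBr mulr1 em_ep subr0. Qed.

Lemma lam_central g : (forall h, g * h = h * g)%g ->
  forall x, lam g * x = x * lam g.
Proof.
move=> gc x; rewrite (galg_lam x) mulr_sumr mulr_suml; apply: eq_bigr => h _.
by rewrite -scalerAr -scalerAl -!lamM gc.
Qed.

Lemma ep_central x : ep * x = x * ep.
Proof.
rewrite /ep -scalerAl -scalerAr mulrDl mulrDr mul1r mulr1 lam_central //.
exact: zq_central.
Qed.

Lemma em_central x : em * x = x * em.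
Proof. by rewrite /em mulrBl mulrBr mul1r mulr1 ep_central. Qed.

Lemma ep_emP x y : x * ep = y * ep -> x * em = y * em -> x = y.
Proof.
move=> e1 e2.
by rewrite -[x]mulr1 -[y]mulr1 -epDem (mulrDr x) (mulrDr y) e1 e2.
Qed.

Lemma lam_em g k : (lam g * em : K) k = 2^-1 * ((k == g)%:R - (k == g * zq)%g%:R).
Proof. by rewrite emE -scalerAr mulrBr mulr1 -lamM !ffunE. Qed.

Lemma lam_ep g k : (lam g * ep : K) k = 2^-1 * ((k == g)%:R + (k == g * zq)%g%:R).
Proof. by rewrite -scalerAr mulrDr mulr1 -lamM !ffunE. Qed.

Lemma mulg_zq_neq g : (g == g * zq)%g = false.
Proof. by apply/negbTE; rewrite -{1}[g]mulg1 (inj_eq (mulgI g)) eq_sym zq_neq1. Qed.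

(** Multiplying by [em] makes [g] and [g b^2] opposite, hence still distinct,
    whereas multiplying by [ep] identifies them. *)
Lemma lam_em_inj g h : lam g * em = lam h * em :> K -> g = h.
Proof.
move=> /ffunP/(_ g); rewrite !lam_em eqxx mulg_zq_neq subr0.
have [//|_] := eqVneq g h; move/(mulfI (invr_neq0 _)) => /(_ _) e.
have {e} : 1 = 0 - (g == h * zq)%g%:R :> C by apply: e; rewrite pnatr_eq0.
case: (_ == _); rewrite sub0r ?oppr0 => /eqP.
  by rewrite -addr_eq0 -mulr2n pnatr_eq0.
by rewrite oner_eq0.
Qed.

Lemma lam_ep_inj g h : lam g * ep = lam h * ep :> K -> g = h \/ g = (h * zq)%g.
Proof.
move=> /ffunP/(_ g); rewrite !lam_ep eqxx mulg_zq_neq addr0.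
have [|_] := eqVneq g h; first by left.
have [|_] := eqVneq g (h * zq)%g; first by right.
by rewrite addr0 mulr0 => /eqP; rewrite mulr1 invr_eq0 pnatr_eq0.
Qed.

Lemma ep_neq0 : ep != 0.
Proof.
apply/eqP=> /ffunP/(_ 1%g)/eqP; rewrite -[ep]mul1r -lam1 lam_ep eqxx mulg_zq_neq.
by rewrite addr0 mulr1 ffunE invr_eq0 pnatr_eq0.
Qed.

Lemma em_neq0 : em != 0.
Proof.
apply/eqP=> /ffunP/(_ 1%g)/eqP; rewrite -[em]mul1r -lam1 lam_em eqxx mulg_zq_neq.
by rewrite subr0 mulr1 ffunE invr_eq0 pnatr_eq0.
Qed.

(** * The twist as a function on pairs of characters of <b> *)

Lemma b4 : (b ^+ 4 = 1)%g.
Proof. by rewrite (expgM _ 2 2) Q_b2 -expgM mulnC Q_aN. Qed.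

Lemma lamb4 : lam b ^+ 4 = 1 :> K.
Proof. by rewrite -lamX b4. Qed.

Lemma P_lamb z : z \in roots4 C -> P n z * lam b = z *: P n z.
Proof. exact: eigenproj_eigen lamb4 z. Qed.

Lemma P_lambX z k : z \in roots4 C -> P n z * lam b ^+ k = z ^+ k *: P n z.
Proof. by move=> zr; apply: eigen_expr; apply: P_lamb. Qed.

Lemma P_id z t : z \in roots4 C -> t \in roots4 C ->
  P n z * P n t = (z == t)%:R *: P n z.
Proof.
by move=> zr tr; exact: (eigen_eigenproj zr tr (P_lamb zr)).
Qed.

Lemma sumP : \sum_(z <- roots4 C) P n z = 1.
Proof. exact: sum_eigenproj (lam b : K). Qed.

(** The element of the algebra of <b> whose Fourier transform is [u], the dual of
    <b> being identified with the fourth roots of unity. *)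
Definition bcalc (u : C -> C) : K := \sum_(z <- roots4 C) u z *: P n z.

(** The same with two factors: an element of the tensor square of the algebra of
    <b> is a function on pairs of characters, and products become pointwise. *)
Definition bcalc2 (w : C -> C -> C) : K2 :=
  \sum_(z <- roots4 C) \sum_(e <- roots4 C) w z e *: gtens (P n z) (P n e).

Lemma Omega'E : Omega' C n = bcalc2 (@omega C).
Proof. by []. Qed.

Lemma eq_bcalc u u' : {in roots4 C, u =1 u'} -> bcalc u = bcalc u'.
Proof. by move=> e; apply: eq_big_seq => z zr; rewrite e. Qed.

Lemma eq_bcalc2 w w' : {in roots4 C &, w =2 w'} -> bcalc2 w = bcalc2 w'.
Proof.
move=> e; apply: eq_big_seq => z zr; apply: eq_big_seq => t tr.
by rewrite e.
Qed.

Lemma P_bcalc z u : z \in roots4 C -> P n z * bcalc u = u z *: P n z.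
Proof.
move=> zr; rewrite /bcalc mulr_sumr (bigD1_seq z zr (roots4_uniq C)) /=.
rewrite -scalerAr P_id // eqxx scale1r big1_seq ?addr0 // => t /andP[tz tr].
by rewrite -scalerAr P_id // eq_sym (negPf tz) scale0r scaler0.
Qed.

Lemma bcalcM u u' : bcalc u * bcalc u' = bcalc (fun z => u z * u' z).
Proof.
rewrite {1}/bcalc mulr_suml; apply: eq_big_seq => z zr.
by rewrite -scalerAl P_bcalc // scalerA.
Qed.

Lemma bcalcZ c u : bcalc (fun z => c * u z) = c *: bcalc u.
Proof. by rewrite /bcalc scaler_sumr; apply: eq_bigr => z _; rewrite scalerA. Qed.

Lemma bcalcD u u' : bcalc (fun z => u z + u' z) = bcalc u + bcalc u'.
Proof. by rewrite /bcalc -big_split; apply: eq_bigr => z _; rewrite scalerDl. Qed.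

Lemma bcalc_1 : bcalc (fun => 1) = 1.
Proof. by rewrite -sumP; apply: eq_bigr => z _; rewrite scale1r. Qed.

Lemma bcalcX k : bcalc (fun z => z ^+ k) = lam b ^+ k.
Proof.
rewrite -[RHS]mul1r -sumP mulr_suml; apply: eq_big_seq => z zr.
by rewrite P_lambX.
Qed.

Lemma bcalc_ep : bcalc (fun z => 2^-1 * (1 + z ^+ 2)) = ep.
Proof. by rewrite bcalcZ bcalcD bcalc_1 bcalcX -lamX Q_b2. Qed.

Lemma bcalc_em : bcalc (fun z => 2^-1 * (1 - z ^+ 2)) = em.
Proof.
rewrite emE -bcalc_1 -Q_b2 lamX -bcalcX -scaleN1r -bcalcZ -bcalcD -bcalcZ.
by apply: eq_bcalc => z _; rewrite mulN1r.
Qed.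

Lemma gtens_bcalc u u' : gtens (bcalc u) (bcalc u') = bcalc2 (fun z t => u z * u' t).
Proof.
rewrite /bcalc gtens_suml; apply: eq_bigr => z _; rewrite gtens_sumr.
by apply: eq_bigr => t _; rewrite gtensZl gtensZr scalerA.
Qed.

Lemma bcalc2M w w' : bcalc2 w * bcalc2 w' = bcalc2 (fun z t => w z t * w' z t).
Proof.
rewrite {1}/bcalc2 mulr_suml; apply: eq_big_seq => z zr.
rewrite mulr_suml; apply: eq_big_seq => t tr.
rewrite -scalerAl -scalerA; congr (_ *: _).
rewrite /bcalc2 mulr_sumr (bigD1_seq z zr (roots4_uniq C)) /= addrC big1_seq
  ?add0r; last first.
  move=> z' /andP[zz zr']; rewrite mulr_sumr big1_seq // => t' _.
  rewrite -scalerAr gtensM P_id // eq_sym (negPf zz) scale0r.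
  by rewrite -(scale0r (0 : K)) gtensZl scale0r scaler0.
rewrite mulr_sumr (bigD1_seq t tr (roots4_uniq C)) /= addrC big1_seq
  ?add0r; last first.
  move=> t' /andP[tt tr']; rewrite -scalerAr gtensM (P_id tr) // eq_sym (negPf tt).
  by rewrite gtensZr scale0r scaler0.
by rewrite -scalerAr gtensM !P_id // !eqxx !scale1r.
Qed.

Lemma bcalc2_1 : bcalc2 (fun _ _ => 1) = 1.
Proof.
by rewrite -gtens1 -bcalc_1 gtens_bcalc; apply: eq_bcalc2 => z t _ _; rewrite mulr1.
Qed.

(** The star of an eigenvector of [b] for [z] is again one, because
    [b^* = b^-1] and [z^* = z^-1]; multiplying it by [P z] shows that [P z] and its
    star agree. *)
Lemma gstarP z : z \in roots4 C -> gstar (P n z) = P n z.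
Proof.
move=> zr; have Pb : gstar (P n z) * lam b = z *: gstar (P n z).
  have e : lam b^-1%g * gstar (P n z) = z^* *: gstar (P n z).
    by rewrite -gstar_lam -gstarM P_lamb //; apply: gstarZ.
  have bP : lam b * gstar (P n z) = gstar (P n z) * lam b.
    rewrite /P gstarZ gstar_sum -scalerAl -scalerAr mulr_suml mulr_sumr.
    congr (_ *: _); apply: eq_bigr => s _.
    rewrite gstarZ -lamX gstar_lam -scalerAl -scalerAr -!lamM.
    by rewrite (commuteV (commuteX s (commute_refl b))).
  rewrite -bP -[gstar (P n z) in RHS]mul1r -lam1 -(mulgV b) lamM -mulrA e.
  by rewrite -scalerAr scalerA mulrC roots4_conjM // scale1r.
have PP : gstar (P n z) * P n z = gstar (P n z).
  by have := eigen_eigenproj zr zr Pb; rewrite eqxx scale1r.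
by rewrite -[RHS]gstarK -PP gstarM gstarK PP.
Qed.

Lemma gstar_bcalc2 w : gstar (bcalc2 w) = bcalc2 (fun z t => (w z t)^*).
Proof.
rewrite gstar_sum; apply: eq_big_seq => z zr; rewrite gstar_sum.
by apply: eq_big_seq => t tr; rewrite gstarZ gstar_gtens !gstarP.
Qed.

Lemma gstar_bcalc u : gstar (bcalc u) = bcalc (fun z => (u z)^*).
Proof.
by rewrite gstar_sum; apply: eq_big_seq => z zr; rewrite gstarZ !gstarP.
Qed.

(** On the two characters of <b> that are -1 at [b^2], the matrix of [omega] is
    [[1, i; -i, 1]], of rank one: it is the product of the column [(1, -i)] and of
    its conjugate row.  This column defines [vtw]. *)
Definition vtw : K :=
  bcalc (fun z => if z == 'i then 1 else if z == - 'i then - 'i else 0).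

Lemma gstar_ep : gstar ep = ep.
Proof.
by rewrite /ep gstarZ gstarD -lam1 !gstar_lam invg1 fmorphV /= conjC_nat
  -(mulg1 zq^-1)%g -zqK mulKg.
Qed.

Lemma gstar_em : gstar em = em.
Proof.
by rewrite /em -scaleN1r gstarD gstarZ gstar_ep rmorphN1 -lam1 gstar_lam invg1.
Qed.

(* Identities between elements of C[<b>] (x) C[<b>] are checked at the sixteen pairs
   of characters. *)
Ltac by_roots4 :=
  rewrite !inE => /or4P[] /eqP-> /or4P[] /eqP->;
  rewrite ?omegaE ?roots4_neq ?conjC_roots4 ?rmorph0 /=;
  by field: (sqrCi C).

Ltac by_root4 :=
  rewrite !inE => /or4P[] /eqP->;
  rewrite ?roots4_neq ?conjC_roots4 ?rmorph0 /=;
  by field: (sqrCi C).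

Lemma Omega'_unitary : Omega' C n * gstar (Omega' C n) = 1.
Proof.
rewrite Omega'E gstar_bcalc2 bcalc2M -bcalc2_1; apply: eq_bcalc2 => z t; by_roots4.
Qed.

Lemma Omega'_unitary' : gstar (Omega' C n) * Omega' C n = 1.
Proof.
rewrite Omega'E gstar_bcalc2 bcalc2M -bcalc2_1; apply: eq_bcalc2 => z t; by_roots4.
Qed.

Lemma Omega'_ep : Omega' C n * gtens ep ep = gtens ep ep.
Proof.
rewrite Omega'E -bcalc_ep gtens_bcalc bcalc2M.
apply: eq_bcalc2 => z t; by_roots4.
Qed.

(** This is where the twist becomes a pure tensor. *)
Lemma Omega'_em : Omega' C n * gtens em em = gtens vtw (gstar vtw).
Proof.
rewrite Omega'E -bcalc_em gstar_bcalc !gtens_bcalc bcalc2M.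
apply: eq_bcalc2 => z t; by_roots4.
Qed.

(** [omega^2] is [-1] at the pairs of distinct nontrivial characters and [1]
    elsewhere.  At a pair [(z, t)] with [z^2 = 1] and [t^2 = -1] this is [z], the
    eigenvalue of [b]; if [z^2 = t^2 = -1] it is [- z t]. *)
Lemma Omega'2_ep_em : Omega' C n * Omega' C n * gtens ep em = gtens (lam b * ep) em.
Proof.
rewrite Omega'E -bcalc_em -bcalc_ep -[lam b]expr1 -bcalcX bcalcM !gtens_bcalc !bcalc2M.
apply: eq_bcalc2 => z t; by_roots4.
Qed.

Lemma Omega'2_em_ep : Omega' C n * Omega' C n * gtens em ep = gtens em (lam b * ep).
Proof.
rewrite Omega'E -bcalc_em -bcalc_ep -[lam b]expr1 -bcalcX bcalcM !gtens_bcalc !bcalc2M.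
apply: eq_bcalc2 => z t; by_roots4.
Qed.

Lemma Omega'2_em_em :
  Omega' C n * Omega' C n * gtens em em = - gtens (lam b * em) (lam b * em).
Proof.
rewrite -scaleN1r -gtensZl -[lam b * em]scale1r.
rewrite Omega'E -bcalc_em -[lam b]expr1 -bcalcX bcalcM -!bcalcZ !gtens_bcalc !bcalc2M.
apply: eq_bcalc2 => z t; by_roots4.
Qed.

Lemma vtwV : vtw * gstar vtw = em.
Proof.
rewrite /vtw gstar_bcalc bcalcM -bcalc_em; apply: eq_bcalc => z; by_root4.
Qed.

Lemma vtwVl : gstar vtw * vtw = em.
Proof.
rewrite /vtw gstar_bcalc bcalcM -bcalc_em; apply: eq_bcalc => z; by_root4.
Qed.

Lemma vtw_em : vtw * em = vtw.
Proof.
rewrite /vtw -bcalc_em bcalcM; apply: eq_bcalc => z; by_root4.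
Qed.

(** Commuting with [vtw^2] is thus the same as commuting with [b em]. *)
Lemma vtw_sqr : vtw * vtw = - 'i *: (lam b * em).
Proof.
rewrite /vtw -bcalc_em -[lam b]expr1 -bcalcX !bcalcM -bcalcZ.
apply: eq_bcalc => z; by_root4.
Qed.

Lemma lamb_vtw : lam b * vtw = vtw * lam b.
Proof.
rewrite /vtw -[lam b]expr1 -bcalcX !bcalcM.
by apply: eq_bcalc => z _; rewrite mulrC.
Qed.

End Quaternion.

(** * The twisted coproduct on the blocks of the two ideals *)

Section Comultiplication.
Variables (C : numClosedFieldType) (n : nat).
Hypothesis n0 : (0 < n)%N.
Local Notation K := (galg C (Qn n)).
Local Notation K2 := (galg C (Qn n * Qn n)%type).
Local Notation zq := (Qa n ^+ n)%g.
Local Notation Om := (Omega' C n).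
Local Notation ep := (ep C n).
Local Notation em := (em C n).
Local Notation v := (vtw C n).
Local Notation v' := (gstar (vtw C n)).
Implicit Types (x y : K) (g h : Qn n).

Lemma Delta_is_linear : linear (@Delta C n).
Proof.
by move=> c x y; rewrite /Delta linearP mulrDr mulrDl -scalerAr -scalerAl.
Qed.

HB.instance Definition _ :=
  GRing.isLinear.Build C K K2 *:%R (@Delta C n) Delta_is_linear.

Lemma DeltaM : {morph (@Delta C n) : x y / x * y}.
Proof.
move=> x y; rewrite /Delta Delta_sM -!mulrA; congr (_ * (_ * _)).
by rewrite (mulrA (gstar Om)) Omega'_unitary' // mul1r.
Qed.

Lemma gtens_central x y : (forall t, x * t = t * x) -> (forall t, y * t = t * y) ->
  forall X : K2, gtens x y * X = X * gtens x y.
Proof.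
move=> xc yc X; rewrite (galg_lam X) mulr_sumr mulr_suml.
apply: eq_bigr => -[g h] _; rewrite -scalerAr -scalerAl -gtens_lam !gtensM.
by rewrite xc yc.
Qed.

Lemma gtens_ep_central (X : K2) : gtens ep ep * X = X * gtens ep ep.
Proof. by apply: gtens_central; apply: ep_central. Qed.

Lemma gtens_em_central (X : K2) : gtens em em * X = X * gtens em em.
Proof. by apply: gtens_central; apply: em_central. Qed.

Lemma em_vtw : em * v = v.
Proof. by rewrite em_central vtw_em. Qed.

Lemma em_vtwV : em * v' = v'.
Proof. by rewrite -{2}(vtw_em C n) gstarM gstar_em. Qed.

(** [Omega'] acts as the identity on [ep (x) ep]. *)
Lemma Delta_epep x : gtens ep ep * Delta x = gtens ep ep * Delta_s x.
Proof.
have e : gstar Om * gtens ep ep = gtens ep ep.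
  by rewrite -gtens_ep_central -{1 2}gstar_ep -gstar_gtens -gstarM Omega'_ep
    gstar_gtens !gstar_ep.
rewrite gtens_ep_central /Delta -mulrA e -gtens_ep_central mulrA.
by rewrite gtens_ep_central Omega'_ep.
Qed.

(** [b^2 (x) b^2] acts as [(-1)(-1) = 1] on [em (x) em]. *)
Lemma Delta_s_ep : Delta_s ep * gtens em em = gtens em em.
Proof.
rewrite /ep linearZ /= linearD /= -lam1 !Delta_s_lam lam1 gtens1 -scalerAl.
rewrite mulrDl mul1r gtensM !zq_em -scaleN1r gtensZl gtensZr scalerA mulrNN mulr1.
by rewrite scale1r -mulr2n -scaler_nat scalerA mulVf ?scale1r // pnatr_eq0.
Qed.

(** On this block [Delta_s x] depends on [x ep] alone, because [Delta_s ep] acts there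
    as the identity; and the twist is [vtw (x) vtw^*]. *)
Lemma Delta_emem x h : x * ep = lam h * ep ->
  gtens em em * Delta x = gtens (v * lam h * v') (v' * lam h * v).
Proof.
move=> xh.
have e : gstar Om * gtens em em = gtens v' v.
  by rewrite -gtens_em_central -{1 2}gstar_em -gstar_gtens -gstarM Omega'_em
    gstar_gtens gstarK.
have E : Om * gtens em em = gtens v v' by exact: Omega'_em.
have Dx : Delta_s x * gtens em em = gtens (lam h) (lam h) * gtens em em.
  by rewrite -{1}Delta_s_ep mulrA -Delta_sM xh Delta_sM -mulrA Delta_s_ep
    Delta_s_lam.
have EE : gtens em em * gtens em em = gtens em em by rewrite gtensM em_id.
have -> : gtens em em * Delta x = gtens v v' * Delta_s x * gtens v' v.
  rewrite -{1}EE -mulrA gtens_em_central /Delta -!mulrA e !mulrA.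
  by rewrite (gtens_em_central Om) E.
have W : gtens v' v = gtens em em * gtens v' v by rewrite gtensM em_vtw em_vtwV.
rewrite W mulrA -(mulrA _ (Delta_s x)) Dx -!mulrA -W !gtensM.
by rewrite !mulrA.
Qed.

(** In a group algebra the coordinate form of [Delta_s u = u (x) u] reads
    [u_g u_h = 0] for [g <> h]: only one group element occurs in [u].  The same
    argument is applied to [u = x ep], whose coordinates at [h] and [h b^2] agree. *)
Lemma grouplike_ep x y : y * x = 1 ->
  gtens ep ep * Delta_s x = gtens (x * ep) (x * ep) ->
  exists h, x * ep = lam h * ep.
Proof.
move=> yx /ffunP e; pose u := x * ep.
have u0 : u != 0.
  apply: contraNneq (ep_neq0 C n0) => u0.
  by rewrite -[ep]mul1r -yx -mulrA -/u u0 mulr0.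
have [h uh] := galg_neq0 u0.
exists h; apply/ffunP=> g; apply: (mulIf uh).
have /esym := e (g, h); rewrite [in X in X -> _]ffunE -/u /= => ->.
have -> : u h = \sum_k x k * (lam k * ep : K) h.
  rewrite /u {1}(galg_lam x) mulr_suml sum_ffunE; apply: eq_bigr => k _.
  by rewrite -scalerAl ffunE.
rewrite {1}(galg_lam x) linear_sum mulr_sumr sum_ffunE mulr_sumr.
apply: eq_bigr => k _ /=.
have -> : Delta_s (x k *: lam k) = x k *: gtens (lam k) (lam k).
  by rewrite linearZ /= Delta_s_lam.
rewrite -scalerAr gtensM.
rewrite !ep_central ffunE [gtens _ _ _]ffunE /= mulrCA; congr (_ * _).
have [->//|kh] := eqVneq k h.
have [->|kh'] := eqVneq k (h * zq)%g.
  by rewrite lamM -mulrA zq_ep.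
suff -> : (lam k * ep : K) h = 0 by rewrite !mulr0.
rewrite lam_ep eq_sym (negPf kh) [h == _](_ : _ = false) ?addr0 ?mulr0 //.
by apply: contra_neqF kh' => /eqP->; rewrite -mulgA zqK mulg1.
Qed.

End Comultiplication.

(** * Algebra endomorphisms *)

Section Endomorphisms.
Variables (C : numClosedFieldType) (n : nat).
Local Notation K := (galg C (Qn n)).
Local Notation a := (Qa n).
Local Notation b := (Qb n).
Local Notation zq := (Qa n ^+ n)%g.
Local Notation ep := (ep C n).
Local Notation em := (em C n).
Implicit Types (x y : K) (g h : Qn n) (f : {lrmorphism K -> K}).

(** [kac_automorphism] consists of equations on a bare map; this packs them, so that
    the rules for morphisms apply. *)
Lemma lrmorphism_of (f : K -> K) : linear f -> {morph f : x y / x * y} -> f 1 = 1 ->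
  exists F : {lrmorphism K -> K}, (F : K -> K) = f.
Proof.
move=> fL fM f1.
pose F : {lrmorphism K -> K} := HB.pack f
  (GRing.isLinear.Build C K K *:%R f fL)
  (GRing.isMonoidMorphism.Build K K f (conj f1 fM)).
by exists F.
Qed.

Lemma lrmorphism_eq f f' : f (lam a) = f' (lam a) -> f (lam b) = f' (lam b) ->
  f =1 f'.
Proof. by move=> ea eb x; rewrite (qext_unique f) ea eb -qext_unique. Qed.

(** Meant for [Delta o f] and [(f (x) f) o Delta], which are multiplicative without
    being endomorphisms. *)
Lemma lam_gen_eq (M : pzSemiRingType) (F G : K -> M) :
  F 1 = 1 -> G 1 = 1 -> {morph F : x y / x * y} -> {morph G : x y / x * y} ->
  F (lam a) = G (lam a) -> F (lam b) = G (lam b) -> forall g, F (lam g) = G (lam g).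
Proof.
move=> F1 G1 FM GM ea eb g.
have FX x k : F (x ^+ k) = F x ^+ k.
  by elim: k => [|k IHk]; rewrite ?expr0 // !exprS FM IHk.
have GX x k : G (x ^+ k) = G x ^+ k.
  by elim: k => [|k IHk]; rewrite ?expr0 // !exprS GM IHk.
by rewrite (Q_elt g) lamM !lamX FM GM !FX !GX ea eb.
Qed.

Lemma lrmorphism_lamV f g h : f (lam g) = lam h ->
  f (lam g^-1%g) = lam h^-1%g.
Proof.
move=> fg; rewrite -[LHS]mul1r -lam1 -(mulVg h) lamM -fg -mulrA -rmorphM -lamM.
by rewrite mulgV lam1 rmorph1 mulr1.
Qed.

Lemma lrmorphism_ep f : f (lam zq) = lam zq -> f ep = ep.
Proof. by move=> fz; rewrite /ep linearZ linearD /= rmorph1 fz. Qed.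

Lemma lrmorphism_em f : f (lam zq) = lam zq -> f em = em.
Proof. by move=> fz; rewrite /em linearB /= rmorph1 lrmorphism_ep. Qed.

Lemma lrmorphism_zq_fix f : f (lam b) = lam b -> f (lam zq) = lam zq.
Proof. by move=> fb; rewrite -Q_b2 lamX rmorphXn /= fb. Qed.

Lemma lrmorphism_zq_inv f : f (lam b) = lam b^-1%g -> f (lam zq) = lam zq.
Proof. by move=> fb; rewrite -Q_b2 lamX rmorphXn /= fb -!lamX expgVn Q_b2 zqV. Qed.

Lemma P_fix f z : f (lam b) = lam b -> f (P n z) = P n z.
Proof.
move=> fb; rewrite /P linearZ linear_sum; congr (_ *: _); apply: eq_bigr => s _.
by rewrite linearZ /= rmorphXn /= fb.
Qed.

Lemma bcalc_fix f u : f (lam b) = lam b -> f (bcalc n u) = bcalc n u.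
Proof.
move=> fb; rewrite linear_sum; apply: eq_bigr => z _.
by rewrite linearZ /= P_fix.
Qed.

End Endomorphisms.

(** * Automorphisms are determined by their values at the generators *)

Section Automorphism.
Variables (C : numClosedFieldType) (n : nat).
Hypothesis hn : (3 <= n)%N.
Let n0 : (0 < n)%N. Proof. exact: leq_trans hn. Qed.
Local Notation K := (galg C (Qn n)).
Local Notation K2 := (galg C (Qn n * Qn n)%type).
Local Notation a := (Qa n).
Local Notation b := (Qb n).
Local Notation zq := (Qa n ^+ n)%g.
Local Notation ep := (ep C n).
Local Notation em := (em C n).
Local Notation v := (vtw C n).
Local Notation v' := (gstar (vtw C n)).
Variable f : {lrmorphism K -> K}.
Hypothesis fbij : bijective f.
Hypothesis fDelta : forall x, Delta (f x) = gtens_map f (Delta x).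
Implicit Types (x y : K) (g h : Qn n).

Lemma vtwVK x : v' * (v * x * v') * v = em * x * em.
Proof. by rewrite !mulrA vtwVl -!mulrA vtwVl. Qed.

Lemma vtwK x : v * (v' * x * v) * v' = em * x * em.
Proof. by rewrite !mulrA vtwV -!mulrA vtwV. Qed.

Lemma lam_em_neq0 g : lam g * em != 0 :> K.
Proof.
apply: contraNneq (em_neq0 C n0) => g0.
by rewrite -[em]mul1r -lam1 -(mulVg g) lamM -mulrA g0 mulr0.
Qed.

Lemma vtw_conj_neq0 g : v * lam g * v' != 0.
Proof.
apply: contraNneq (lam_em_neq0 g) => g0.
by rewrite -em_id mulrA -(em_central (lam g)) -vtwVK g0 mulr0 mul0r.
Qed.

Lemma vtwV_conj_neq0 g : v' * lam g * v != 0.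
Proof.
apply: contraNneq (lam_em_neq0 g) => g0.
by rewrite -em_id mulrA -(em_central (lam g)) -vtwK g0 mulr0 mul0r.
Qed.

Lemma scale_sqr_eq (V : lmodType C) (x : V) c : x != 0 -> (c * c) *: x = x ->
  c = 1 \/ c = -1.
Proof.
move=> x0 /eqP; rewrite -subr_eq0 -{2}[x]scale1r -scalerBl scaler_eq0 (negPf x0) orbF.
rewrite subr_eq0 -expr2 sqrf_eq1; by case/orP => /eqP; [left | right].
Qed.

(** [x = f(b^2)] is central and group-like.  Its [em] part is proportional to
    [v h v^*], where [x ep = h ep]; so [h em] is central, hence [h] is central in
    [Q_n]. Only [x = 1] and [x = b^2] remain, and [f] is injective. *)
Lemma aut_fix_z : f (lam zq) = lam zq.
Proof.
set x := f (lam zq).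
have zqD : Delta (lam zq) = gtens (lam zq) (lam zq) :> K2.
  rewrite /Delta Delta_s_lam -gtens_central ?mulrA; last 2 first.
  - by apply: lam_central; apply: zq_central.
  - by apply: lam_central; apply: zq_central.
  by rewrite -mulrA Omega'_unitary // mulr1.
have xD : Delta x = gtens x x by rewrite /x fDelta zqD gtens_mapE.
have xx : x * x = 1 by rewrite -rmorphM -lamM zqK lam1 rmorph1.
have [h xh] : exists h, x * ep = lam h * ep.
  apply: (grouplike_ep n0 xx).
  by rewrite -Delta_epep // xD gtensM !ep_central.
have := Delta_emem xh; rewrite xD gtensM.
have x0 : em * x != 0.
  apply: contraNneq (em_neq0 C n0) => e.
  by rewrite -[em]mulr1 -xx mulrA e mul0r.
case/(gtens_eq x0 (vtwV_conj_neq0 h)) => c [e1 e2].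
have xc y : x * y = y * x.
  have [fi _ fK] := fbij; rewrite -(fK y) -!rmorphM; congr (f _).
  by apply: lam_central; apply: zq_central.
have hc y : lam h * em * y = y * (lam h * em).
  have -> : lam h * em = c *: (em * x).
    have -> : lam h * em = em * lam h * em by rewrite em_central -mulrA em_id.
    rewrite -vtwVK e1 -scalerAr -scalerAl; congr (_ *: _).
    by rewrite mulrA -(em_central v') em_vtwV -(xc v') -mulrA vtwVl xc.
  by rewrite -scalerAr -scalerAl (mulrA y) -(em_central y) -!mulrA xc.
have hG g : (h * g = g * h)%g.
  apply: (@lam_em_inj C _ n0); rewrite !lamM -mulrA -(em_central (lam g)) mulrA.
  by rewrite hc mulrA.
have h1z : h = 1%g \/ h = zq.
  rewrite zqE [h]surjective_pairing (commute_a n0 hn (hG a)).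
  by case: (commute_b n0 (hG b)) => ->; [left | right].
have hep : lam h * ep = ep.
  by case: h1z => ->; rewrite ?zq_ep // lam1 mul1r.
have hem : lam h * em = em \/ lam h * em = - em.
  by case: h1z => ->; rewrite ?zq_em // ?lam1 ?mul1r; [left | right].
have vh : v * lam h * v' = lam h * em by rewrite -(lam_central hG) -mulrA vtwV.
have vh' : v' * lam h * v = lam h * em by rewrite -(lam_central hG) -mulrA vtwVl.
have c2 : (c * c) *: (lam h * em) = lam h * em.
  by rewrite -scalerA -{1}vh' -e2 -e1 vh.
have [xe|xe] : x * em = em \/ x * em = - em.
  rewrite -em_central e2 vh'.
  by case: (scale_sqr_eq (lam_em_neq0 h) c2) => ->; case: hem => ->;
    rewrite ?scaleN1r ?scale1r ?opprK; auto.
- have x1 : x = 1 by apply: ep_emP; rewrite mul1r // xh.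
  case/eqP: (zq_neq1 n0); apply: (@lam_inj C); apply: (bij_inj fbij).
  by rewrite -/x x1 lam1 rmorph1.
- by apply: ep_emP; rewrite ?xe ?zq_em // xh hep zq_ep.
Qed.

Lemma aut_fix_ep : f ep = ep.
Proof. exact: lrmorphism_ep aut_fix_z. Qed.

Lemma aut_fix_em : f em = em.
Proof. exact: lrmorphism_em aut_fix_z. Qed.

(** Apply [f] to both blocks of [Delta g], which are [g ep (x) g ep] and
    [v g v^* (x) v^* g v].  The first one yields [h]; then the second block of
    [Delta (f g)] is given by [h] as well, and the scalar [c] is the ambiguity in
    the factors of a pure tensor. *)
Lemma aut_lam g : exists h (c : C), [/\ f (lam g) * ep = lam h * ep,
  v * lam h * v' = c *: f (v * lam g * v') &
  f (v' * lam g * v) = c *: (v' * lam h * v)].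
Proof.
have fgD : Delta (f (lam g)) = gtens_map f (Delta (lam g)) by rewrite fDelta.
have [h xh] : exists h, f (lam g) * ep = lam h * ep.
  apply: (@grouplike_ep _ _ n0 _ (f (lam g^-1))).
    by rewrite -rmorphM -lamM mulVg lam1 rmorph1.
  rewrite -Delta_epep // fgD -{1 2}aut_fix_ep -gtens_mapE -gtens_mapM Delta_epep //.
  by rewrite Delta_s_lam gtensM !ep_central gtens_mapE rmorphM /= aut_fix_ep.
have := Delta_emem xh; rewrite fgD -{1 2}aut_fix_em -gtens_mapE -gtens_mapM.
rewrite (Delta_emem (erefl : lam g * ep = _)) gtens_mapE.
case/gtens_eq => [||c [e1 e2]]; last by exists h, c.
- rewrite -[0](rmorph0 f) (inj_eq (bij_inj fbij)); exact: vtw_conj_neq0.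
- exact: vtwV_conj_neq0.
Qed.

(** Here [n >= 3] enters: in the dihedral quotient by [b^2] the rotation [a]
    has order [n], so it is not an involution. *)
Lemma Qa_sqr_ep : lam (a ^+ 2)%g * ep <> ep.
Proof.
rewrite -[in X in _ <> X](mul1r ep) -lam1 => /(lam_ep_inj n0).
rewrite mul1g !Q_aX => -[] /(congr1 fst) /= /eqP.
  by rewrite natr_Zp_eq0 // => /dvdn_leq; lia.
rewrite -subr_eq0 -[n%:R]ZnN opprK -natrD natr_Zp_eq0 // => /dvdnP[[|[|k]]];
  rewrite ?mulSn; lia.
Qed.

Lemma aut_ep_inj g h : f (lam g) * ep = f (lam h) * ep -> lam g * ep = lam h * ep.
Proof.
by move=> e; apply: (bij_inj fbij); rewrite !rmorphM /= aut_fix_ep.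
Qed.

Lemma aut_ep_mul g g' h h' : f (lam g) * ep = lam h * ep ->
  f (lam g') * ep = lam h' * ep -> f (lam (g * g')%g) * ep = lam (h * h')%g * ep.
Proof.
move=> e e'; rewrite !lamM rmorphM /= -!mulrA e' -ep_central mulrA e.
by rewrite -mulrA.
Qed.

(** In the dihedral quotient reflections are involutions, and [a] is not one. *)
Lemma aut_a_rot h : f (lam a) * ep = lam h * ep -> h.2 = false.
Proof.
move=> ha; apply/negbTE/negP => h2; apply: Qa_sqr_ep.
rewrite -[RHS](mul1r ep) -lam1; apply: aut_ep_inj.
by rewrite (aut_ep_mul ha ha) Qsqr // zq_ep lam1 rmorph1 mul1r.
Qed.

(** The images of [a] and [b] in the dihedral quotient do not commute. *)
Lemma aut_b_refl h : f (lam b) * ep = lam h * ep -> h.2.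
Proof.
move=> hb; have [h' [c [ha _ _]]] := aut_lam a.
apply: contraT => /negbTE h2; case: Qa_sqr_ep.
have : lam (a * b)%g * ep = lam (b * a)%g * ep.
  apply: aut_ep_inj; rewrite (aut_ep_mul ha hb) (aut_ep_mul hb ha).
  by rewrite Qrot_commute // (aut_a_rot ha).
move=> /(congr1 (fun x => lam a * x * lam b^-1%g)).
rewrite -!mulrA !ep_central !mulrA -!lamM Q_ba !mulgA !mulgK mulgV lam1 mul1r.
exact.
Qed.

(** Let [y = f(b) em].  As [b] commutes with [v], the two equations of [aut_lam] read
    [v h v^* = c y] and [y = c v^* h v].  Squaring the second one gives
    [c^2 = 1], hence [v h v^* = v^* h v]; multiplied by [v] on both sides this says
    that [h] commutes with [v^2], that is with [b]. *)
Lemma aut_b : f (lam b) = lam b \/ f (lam b) = lam b^-1%g.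
Proof.
have [h [c [hb e1 e2]]] := aut_lam b.
have h2 := aut_b_refl hb.
have bv' : lam b * v' = v' * lam b.
  rewrite /vtw gstar_bcalc -[lam b]expr1 -bcalcX !bcalcM.
  by apply: eq_bcalc => z _; rewrite mulrC.
pose y := f (lam b) * em; have fem := aut_fix_em.
have {}e1 : v * lam h * v' = c *: y.
  by rewrite e1 -lamb_vtw -mulrA vtwV rmorphM /= fem.
have {}e2 : y = c *: (v' * lam h * v).
  by rewrite -e2 -bv' -mulrA vtwVl rmorphM /= fem.
have y2 : y * y = - em.
  rewrite /y -mulrA (mulrA em) em_central -mulrA em_id mulrA -rmorphM -lamM Qb_sqr /=.
  by rewrite aut_fix_z zq_em.
have vhv2 : (v' * lam h * v) * (v' * lam h * v) = - em.
  rewrite -!mulrA (mulrA v) vtwV (mulrA em) em_central -!mulrA em_vtw (mulrA (lam h)).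
  by rewrite -lamM Qsqr // mulrA -(lam_central (@zq_central n)) -mulrA vtwVl zq_em.
have c2 : (c * c) *: em = em.
  have := y2; rewrite {1 2}e2 -scalerAl -scalerAr scalerA vhv2 scalerN.
  exact: oppr_inj.
have vh : v * lam h * v' = v' * lam h * v.
  rewrite e1 e2 scalerA -{1}em_vtwV -!mulrA scalerAl c2.
  by rewrite !mulrA em_vtwV.
have bh : (b * h = h * b)%g.
  have L : v * (v * lam h * v') * v = - 'i *: (lam b * lam h * em).
    rewrite !mulrA vtw_sqr -!scalerAl -!mulrA vtwVl; congr (_ *: _).
    by rewrite (mulrA em) em_central -mulrA em_id.
  have R : v * (v' * lam h * v) * v = - 'i *: (lam h * lam b * em).
    rewrite -!mulrA vtw_sqr (mulrA v) vtwV -!scalerAr; congr (_ *: _).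
    by rewrite em_central -!mulrA em_id.
  apply: (@lam_em_inj C _ n0); apply: (scalerI (a := - 'i)).
    by rewrite oppr_eq0 neq0Ci.
  by rewrite (lamM _ b h) (lamM _ h b) -L -R vh.
have hz : h = b \/ h = (zq * b)%g.
  rewrite [h]surjective_pairing h2 zqE.
  case: (commute_b n0 (esym bh)) => ->; [left | right] => //.
  by congr pair; rewrite /= !addr0.
have hep : lam h * ep = lam b * ep.
  by case: hz => -> //; rewrite zq_central lamM -mulrA zq_ep.
have hem : v' * lam h * v = lam h * em.
  suff -> : v' * lam h = lam h * v' by rewrite -mulrA vtwVl.
  case: hz => ->; first by rewrite bv'.
  by rewrite lamM mulrA -(lam_central (@zq_central n)) -!mulrA bv'.
have bem : lam b^-1%g * em = - (lam b * em).
  by rewrite QbV zq_central lamM -mulrA zq_em mulrN.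
have {}e2 : y = lam b * em \/ y = lam b^-1%g * em.
  rewrite e2 hem bem; case: hz => ->; rewrite -?QbV ?bem;
    case: (scale_sqr_eq (em_neq0 C n0) c2) => ->;
    rewrite ?scaleN1r ?scale1r ?opprK; by [left | right].
have bep : lam b^-1%g * ep = lam b * ep.
  by rewrite QbV zq_central lamM -mulrA zq_ep.
by case: e2 => e2; [left | right]; apply: ep_emP; rewrite ?bep // hb.
Qed.

(** Since [f] fixes [v], the two equations of [aut_lam] become [h em = c f(a) em] and
    [f(a) em = c h em], so [f(a) em] is [h em] or [- h em = b^2 h em]; both agree
    with [h] on [ep]. *)
Lemma aut_a : f (lam b) = lam b -> exists k, f (lam a) = lam (a ^+ k)%g.
Proof.
move=> fb; have [h [c [ha]]] := aut_lam a.
rewrite !rmorphM /= gstar_bcalc !bcalc_fix // -gstar_bcalc.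
set x := f (lam a) => e1 e2; have h2 := aut_a_rot ha.
have conj1 y : v' * (v * y * v') * v = y * em.
  by rewrite vtwVK em_central -mulrA em_id.
have conj2 y : v * (v' * y * v) * v' = y * em.
  by rewrite vtwK em_central -mulrA em_id.
have {}e1 : lam h * em = c *: (x * em).
  by rewrite -conj1 e1 -scalerAr -scalerAl conj1.
have {}e2 : x * em = c *: (lam h * em).
  by rewrite -conj2 e2 -scalerAr -scalerAl conj2.
have c2 : (c * c) *: (lam h * em) = lam h * em by rewrite -scalerA -e2 -e1.
have {h2} [k hk] : exists k, h = (a ^+ k)%g.
  by exists h.1; rewrite {1}(Q_elt h) h2 mulg1.
case: (scale_sqr_eq (lam_em_neq0 h) c2) e2 => -> e2.
  by exists k; rewrite -hk; apply: ep_emP; rewrite // e2 scale1r.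
(* The sign is absorbed by the factor [a ^+ n = b ^+ 2], which is 1 on [ep]. *)
exists (n + k)%N; rewrite expgD -hk; apply: ep_emP.
  by rewrite ha zq_central lamM -mulrA zq_ep.
by rewrite zq_central lamM -mulrA zq_em e2 scaleN1r mulrN.
Qed.

(** If [k] and [2 n] had a common divisor [d > 1], the nontrivial element
    [a^(2 n / d)] would be mapped to [1]. *)
Lemma aut_Theta : f (lam b) = lam b -> exists2 k, coprime k (2 * n) & f =1 Theta k.
Proof.
move=> fb; have [k fa] := aut_a fb; exists k; last first.
  by move=> x; rewrite [LHS]qext_unique fa fb.
rewrite /coprime; set d := gcdn _ _.
have d0 : (0 < d)%N by rewrite gcdn_gt0; apply/orP; right; lia.
have /dvdnP[q qd] : (d %| 2 * n)%N by apply: dvdn_gcdr.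
have /dvdnP[r rd] : (d %| k)%N by apply: dvdn_gcdl.
have : (a ^+ q = 1)%g.
  apply: (@lam_inj C); apply: (bij_inj fbij).
  rewrite lamX rmorphXn /= fa -lamX -expgM rd -mulnA (mulnC d) -qd mulnC expgM.
  by rewrite Q_aN expg1n lam1 rmorph1.
rewrite Q_aX => /(congr1 fst) /eqP; rewrite natr_Zp_eq0 // qd => qdq.
have q0 : (0 < q)%N by case: (q) qd => //; lia.
by have := dvdn_leq q0 qdq; rewrite -[leqRHS]muln1 leq_pmul2l //; case: (d) d0 => [|[]].
Qed.

End Automorphism.

(** * Compatibility with the coproduct, and the automorphisms Theta_k *)

Section Converse.
Variables (C : numClosedFieldType) (n : nat).
Hypothesis n0 : (0 < n)%N.
Local Notation K := (galg C (Qn n)).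
Local Notation K2 := (galg C (Qn n * Qn n)%type).
Local Notation a := (Qa n).
Local Notation b := (Qb n).
Local Notation zq := (Qa n ^+ n)%g.
Local Notation Om := (Omega' C n).
Local Notation ep := (ep C n).
Local Notation em := (em C n).
Local Notation u := (Theta'_a C n).
Implicit Types (x y : K) (g h : Qn n) (f : {lrmorphism K -> K}).

Lemma Delta1 : Delta 1 = 1 :> K2.
Proof.
by rewrite /Delta -lam1 Delta_s_lam lam1 gtens1 mulr1 Omega'_unitary.
Qed.

Lemma comul_of_generators f :
  Delta (f (lam a)) = gtens_map f (Delta (lam a)) ->
  Delta (f (lam b)) = gtens_map f (Delta (lam b)) ->
  forall x, Delta (f x) = gtens_map f (Delta x).
Proof.
move=> ea eb.
apply: (@galg_linear_eq _ _ _ (@Delta C n \o f) (gtens_map f \o @Delta C n)).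
pose F x : K2 := Delta (f x); pose G x : K2 := gtens_map f (Delta x).
have F1 : F 1 = 1 by rewrite /F rmorph1 Delta1.
have G1 : G 1 = 1 by rewrite /G Delta1 -gtens1 gtens_mapE rmorph1.
have FM : {morph F : x y / x * y} by move=> x y; rewrite /F rmorphM DeltaM.
have GM : {morph G : x y / x * y} by move=> x y; rewrite /G DeltaM gtens_mapM.
exact: (lam_gen_eq F1 G1 FM GM ea eb).
Qed.

(** The star of a unitary is its inverse, which algebra morphisms preserve; and
    products of unitaries are unitary. *)
Lemma star_of_generators f :
  gstar (f (lam a)) * f (lam a) = 1 -> gstar (f (lam b)) * f (lam b) = 1 ->
  {morph f : x / gstar x}.
Proof.
move=> ua ub x; have star1 : gstar 1 = 1 :> K by rewrite -lam1 gstar_lam invg1.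
have ug g : gstar (f (lam g)) * f (lam g) = 1.
  have uM y y' : gstar y * y = 1 -> gstar y' * y' = 1 ->
      gstar (y * y') * (y * y') = 1.
    by move=> uy uy'; rewrite gstarM -mulrA (mulrA (gstar y)) uy mul1r.
  have uX y k : gstar y * y = 1 -> gstar (y ^+ k) * y ^+ k = 1.
    move=> uy; elim: k => [|k IHk]; first by rewrite expr0 star1 mul1r.
    by rewrite exprS; apply: uM.
  by rewrite (Q_elt g) lamM !lamX rmorphM !rmorphXn; apply: uM; apply: uX.
rewrite {1}(galg_lam x) gstar_sum linear_sum {2}(galg_lam x) linear_sum gstar_sum.
apply: eq_bigr => g _; rewrite gstarZ !linearZ /= gstarZ gstar_lam; congr (_ *: _).
rewrite -[LHS]mul1r -(ug g) -mulrA -rmorphM -lamM mulgV lam1 rmorph1.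
by rewrite mulr1.
Qed.

Lemma kac_comp (f1 f2 : K -> K) : kac_automorphism (@Delta C n) f1 ->
  kac_automorphism (@Delta C n) f2 -> kac_automorphism (@Delta C n) (f1 \o f2).
Proof.
move=> [l1 m1 o1 s1 b1 d1] [l2 m2 o2 s2 b2 d2].
have [F1 e1] := lrmorphism_of l1 m1 o1; have [F2 e2] := lrmorphism_of l2 m2 o2.
split=> [c x y|x y||x||x] /=.
- by rewrite l2 l1.
- by rewrite m2 m1.
- by rewrite o2.
- by rewrite s2 s1.
- exact: bij_comp.
rewrite d1 d2 -e1 -e2.
apply: (@galg_linear_eq _ _ _ (gtens_map F1 \o gtens_map F2)
  (gtens_map (F1 \o F2))) => -[g h].
by rewrite /= !gtens_map_lam gtens_mapE.
Qed.

Lemma Delta_b k :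
  Delta (lam (b ^+ k)%g) = gtens (lam (b ^+ k)%g) (lam (b ^+ k)%g) :> K2.
Proof.
rewrite /Delta Delta_s_lam lamX -bcalcX gtens_bcalc Omega'E gstar_bcalc2 !bcalc2M.
rewrite -[RHS]mul1r -(Omega'_unitary C n) Omega'E gstar_bcalc2 !bcalc2M.
by apply: eq_bcalc2 => z t _ _; rewrite mulrAC.
Qed.

(** [f] acts on the powers of [b] like the star, but linearly: it maps [P z] to
    [(P z^* )^*], and [P z^*] is selfadjoint. *)
Lemma P_inv f z : z \in roots4 C -> f (lam b) = lam b^-1%g -> f (P n z) = P n z^*.
Proof.
move=> zr fb; have zr' := roots4_conj zr.
rewrite -[RHS]gstarP // /P gstarZ fmorphV /= conjC_nat gstar_sum linearZ linear_sum.
congr (_ *: _); apply: eq_bigr => s _.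
rewrite linearZ gstarZ /= rmorphXn /= fb -!lamX gstar_lam expgVn.
by rewrite fmorphV /= rmorphXn /= conjCK.
Qed.

Lemma gtens_map_bcalc2 f w : f (lam b) = lam b -> gtens_map f (bcalc2 n w) = bcalc2 n w.
Proof.
move=> fb; rewrite linear_sum; apply: eq_bigr => z _; rewrite linear_sum.
by apply: eq_bigr => t _; rewrite linearZ /= gtens_mapE /= !P_fix.
Qed.

Lemma gtens_map_bcalc2_inv f w : f (lam b) = lam b^-1%g ->
  gtens_map f (bcalc2 n w) = bcalc2 n (fun z t => w z^* t^*).
Proof.
move=> fb; rewrite linear_sum; apply: etrans (sum_roots4_conj (fun z =>
  \sum_(t <- roots4 C) w z^* t^* *: gtens (P n z) (P n t))).
apply: eq_big_seq => z zr; rewrite conjCK linear_sum.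
apply: etrans (sum_roots4_conj (fun t => w z t^* *: gtens (P n z^*) (P n t))).
by apply: eq_big_seq => t tr; rewrite conjCK linearZ /= gtens_mapE /= !P_inv.
Qed.

(** Complex conjugation exchanges the two lists of pairs defining [omega]. *)
Lemma omega_conj : {in roots4 C &, forall z t, omega z^* t^* = (omega z t)^*}.
Proof.
move=> z t; rewrite !inE => /or4P[] /eqP-> /or4P[] /eqP->;
  by rewrite ?conjC_roots4 ?omegaE ?conjC_roots4.
Qed.

Lemma Omega'_inv f : f (lam b) = lam b^-1%g ->
  gtens_map f Om = gstar Om /\ gtens_map f (gstar Om) = Om.
Proof.
move=> fb; rewrite !Omega'E gstar_bcalc2 !gtens_map_bcalc2_inv //; split.
  by apply: eq_bcalc2; apply: omega_conj.
by apply: eq_bcalc2 => z t zr tr; rewrite omega_conj // conjCK.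
Qed.

Lemma Omega'_fix f : f (lam b) = lam b ->
  gtens_map f Om = Om /\ gtens_map f (gstar Om) = gstar Om.
Proof. by move=> fb; rewrite !Omega'E gstar_bcalc2 !gtens_map_bcalc2. Qed.

Lemma comul_fix_b f g : f (lam b) = lam b -> f (lam a) = lam g ->
  forall x, Delta (f x) = gtens_map f (Delta x).
Proof.
move=> fb fa; have [fO fO'] := Omega'_fix fb; apply: comul_of_generators.
  by rewrite fa /Delta !gtens_mapM fO fO' !Delta_s_lam gtens_mapE /= fa.
by rewrite fb -(expg1 b) Delta_b gtens_mapE expg1 /= fb.
Qed.

Lemma odd_coprime k : coprime k (2 * n) -> odd k.
Proof. by rewrite coprimeMr coprimen2 => /andP[]. Qed.

Lemma Theta_lrmorphism k : odd k ->
  exists F : {lrmorphism K -> K}, (F : K -> K) = Theta k.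
Proof.
move=> ok; apply: lrmorphism_of; first exact: qext_is_linear.
  exact: Theta_mul.
exact: qext1.
Qed.

Lemma ThetaM k l : odd k -> odd l -> Theta k \o Theta l = Theta (k * l) :> (K -> K).
Proof.
move=> ok ol; apply/funext.
have [F eF] := Theta_lrmorphism ok; have [G eG] := Theta_lrmorphism ol.
have okl : odd (k * l) by rewrite oddM ok.
have [H eH] := Theta_lrmorphism okl; rewrite -eF -eG -eH.
apply: (@lrmorphism_eq _ _ (F \o G) H) => /=; rewrite eG eH /Theta.
  by rewrite !qext_a !lamX rmorphXn /= eF /Theta qext_a lamX exprM.
by rewrite !qext_b eF /Theta qext_b.
Qed.

Lemma Theta_mod k l : k = l %[mod 2 * n] -> Theta k = Theta l :> (K -> K).
Proof.
move=> kl; have e : (a ^+ k = a ^+ l)%g.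
  by rewrite -(expg_mod k (Q_aN n)) kl (expg_mod l (Q_aN n)).
by rewrite /Theta e.
Qed.

Lemma Theta1 : Theta 1 = id :> (K -> K).
Proof.
have [F eF] := Theta_lrmorphism (erefl : odd 1); apply/funext; rewrite -eF.
by apply: (@lrmorphism_eq _ _ F idfun); rewrite eF /Theta /= ?qext_a ?qext_b ?expg1.
Qed.

Lemma Theta_bij k : coprime k (2 * n) -> bijective (Theta k : K -> K).
Proof.
move=> ck; have ok := odd_coprime ck.
have k0 : (0 < k)%N by rewrite odd_gt0.
have /coprimeP - /(_ k0) [[u w] /= uw] := ck.
have {}uw : (u * k = w * (2 * n) + 1)%N by lia.
have ku : u * k = 1 %[mod 2 * n] by rewrite uw modnMDl.
have ku' : k * u = 1 %[mod 2 * n] by rewrite mulnC.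
have ou : odd u by move: (congr1 odd uw); rewrite oddM ok andbT oddD !oddM andbF => ->.
have id1 : Theta u \o Theta k = id :> (K -> K).
  by rewrite (ThetaM ou ok) (Theta_mod ku) Theta1.
have id2 : Theta k \o Theta u = id :> (K -> K).
  by rewrite (ThetaM ok ou) (Theta_mod ku') Theta1.
exists (Theta u) => x.
  exact: (congr1 (fun F : K -> K => F x) id1).
exact: (congr1 (fun F : K -> K => F x) id2).
Qed.

Lemma lam_unitary g : gstar (lam g) * lam g = 1 :> K.
Proof. by rewrite gstar_lam -lamM mulVg. Qed.

Lemma kac_Theta k : coprime k (2 * n) -> kac_automorphism (@Delta C n) (Theta k).
Proof.
move=> ck; have ok := odd_coprime ck; have [F eF] := Theta_lrmorphism ok.
have Fa : F (lam a) = lam (a ^+ k)%g by rewrite eF /Theta qext_a.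
have Fb : F (lam b) = lam b by rewrite eF /Theta qext_b.
split.
- exact: qext_is_linear.
- exact: Theta_mul.
- exact: qext1.
- by rewrite -eF; apply: star_of_generators; rewrite ?Fa ?Fb lam_unitary.
- exact: Theta_bij.
- by rewrite -eF; apply: comul_fix_b Fb Fa.
Qed.

(** * The involution Theta' *)

(** Thus [Theta'] fixes [a] on [em K] and inverts it on [ep K]. *)
Lemma Theta'_aE : u = lam a * em + lam a^-1%g * ep.
Proof.
rewrite /Theta'_a scalerAr -[2^-1 *: _]/ep mulrBl opprB addrA addrAC.
by rewrite /em mulrBr mulr1.
Qed.

Lemma Theta'_a_ep : u * ep = lam a^-1%g * ep.
Proof. by rewrite Theta'_aE mulrDl -!mulrA em_ep ep_id mulr0 add0r. Qed.

Lemma Theta'_a_em : u * em = lam a * em.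
Proof. by rewrite Theta'_aE mulrDl -!mulrA ep_em em_id mulr0 addr0. Qed.

Lemma Theta'_lrmorphism : exists F : {lrmorphism K -> K},
  [/\ (F : K -> K) = @Theta' C n, F (lam a) = u & F (lam b) = lam b^-1%g].
Proof.
have [|F eF] := @lrmorphism_of C n (@Theta' C n) _ (Theta'_mul n0) (qext1 _ _).
  exact: qext_is_linear.
by exists F; split=> //; rewrite eF /Theta' ?qext_a ?qext_b ?QbV.
Qed.

(** A one-sided inverse of [u] is its inverse, which is visible on the two ideals. *)
Lemma Theta'_aVE (x : K) : u * x = 1 -> x = lam a^-1%g * em + lam a * ep.
Proof.
move=> ux.
have xV : (lam a^-1%g * em + lam a * ep) * u = 1.
  apply: ep_emP; rewrite mul1r -mulrA ?Theta'_a_ep ?Theta'_a_em mulrDl -!mulrA.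
    rewrite !(mulrA em) !(mulrA ep) !em_central !ep_central -!mulrA em_ep ep_id.
    by rewrite !mulr0 add0r mulrA -lamM mulgV lam1 mul1r.
  rewrite !(mulrA em) !(mulrA ep) !em_central !ep_central -!mulrA ep_em em_id.
  by rewrite !mulr0 addr0 mulrA -lamM mulVg lam1 mul1r.
by rewrite -[LHS]mul1r -xV -mulrA ux mulr1.
Qed.

Lemma Theta'K : @Theta' C n \o @Theta' C n = id.
Proof.
have [F [eF Fa Fb]] := Theta'_lrmorphism; have Fz := lrmorphism_zq_inv Fb.
apply/funext; rewrite -eF; apply: (@lrmorphism_eq _ _ (F \o F) idfun) => /=.
  have FaV : F (lam a^-1%g) = lam a^-1%g * em + lam a * ep.
    by apply: Theta'_aVE; rewrite -Fa -rmorphM -lamM mulgV lam1 rmorph1.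
  rewrite Fa Theta'_aE rmorphD !rmorphM /= Fa FaV.
  rewrite lrmorphism_em // lrmorphism_ep // Theta'_a_em.
  by rewrite mulrDl -!mulrA em_ep ep_id mulr0 add0r -mulrDr addrC epDem mulr1.
by rewrite Fb (lrmorphism_lamV Fb) invgK.
Qed.

Lemma Theta'_bij : bijective (@Theta' C n).
Proof.
by exists (@Theta' C n) => x; apply: (congr1 (fun F : K -> K => F x) Theta'K).
Qed.

Lemma Theta'_a_unitary : gstar u * u = 1.
Proof.
rewrite {1}Theta'_aE gstarD !gstarM gstar_em gstar_ep !gstar_lam invgK.
rewrite em_central ep_central; apply: ep_emP; rewrite mul1r -mulrA.
  rewrite Theta'_a_ep mulrDl -!mulrA !(mulrA em) !(mulrA ep) !em_central !ep_central.
  by rewrite -!mulrA em_ep ep_id !mulr0 add0r mulrA -lamM mulgV lam1 mul1r.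
rewrite Theta'_a_em mulrDl -!mulrA !(mulrA em) !(mulrA ep) !em_central !ep_central.
by rewrite -!mulrA ep_em em_id !mulr0 addr0 mulrA -lamM mulVg lam1 mul1r.
Qed.

Lemma Delta_s_em x y : Delta_s em * gtens x y = gtens x y - Delta_s ep * gtens x y.
Proof.
by rewrite /em linearB /= -lam1 Delta_s_lam lam1 gtens1 mulrBl mul1r.
Qed.

Lemma Delta_s_epE (x y : K) (s t : C) : lam zq * x = s *: x -> lam zq * y = t *: y ->
  Delta_s ep * gtens x y = (2^-1 * (1 + s * t)) *: gtens x y.
Proof.
move=> ex ey; rewrite /ep linearZ /= linearD /= -lam1 !Delta_s_lam lam1 gtens1.
rewrite -scalerAl mulrDl mul1r gtensM ex ey gtensZl gtensZr scalerA.
by rewrite -{1}[gtens x y]scale1r -scalerDl scalerA.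
Qed.

Lemma zq_epZ : lam zq * ep = 1 *: ep. Proof. by rewrite zq_ep scale1r. Qed.
Lemma zq_emZ : lam zq * em = -1 *: em. Proof. by rewrite zq_em scaleN1r. Qed.

(** [Delta_s ep] acts as [1] on the two unmixed blocks and as [0] on the two mixed
    ones, so [Delta_s u] is [a^-1 (x) a^-1] on the former and [a (x) a] on the
    latter. *)
Lemma Delta_s_uE (x y : K) (s t : C) : lam zq * x = s *: x -> lam zq * y = t *: y ->
  s * t = 1 -> Delta_s u * gtens x y = gtens (lam a^-1%g * x) (lam a^-1%g * y).
Proof.
move=> ex ey st; rewrite Theta'_aE linearD /= !Delta_sM mulrDl -!mulrA Delta_s_em.
rewrite (Delta_s_epE ex ey) st.
have -> : 2^-1 * (1 + 1) = 1 :> C by field.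
by rewrite scale1r subrr mulr0 add0r Delta_s_lam gtensM.
Qed.

Lemma Delta_s_uE' (x y : K) (s t : C) : lam zq * x = s *: x -> lam zq * y = t *: y ->
  s * t = -1 -> Delta_s u * gtens x y = gtens (lam a * x) (lam a * y).
Proof.
move=> ex ey st; rewrite Theta'_aE linearD /= !Delta_sM mulrDl -!mulrA Delta_s_em.
rewrite (Delta_s_epE ex ey) st subrr mulr0 scale0r mulr0 addr0 subr0.
by rewrite Delta_s_lam gtensM.
Qed.

Lemma gtens_ep_emP (X Y : K2) :
  (forall x y, x \in [:: ep; em] -> y \in [:: ep; em] ->
     X * gtens x y = Y * gtens x y) -> X = Y.
Proof.
move=> e; have E : gtens ep ep + gtens ep em + (gtens em ep + gtens em em) = 1.
  by rewrite -!gtensDr -gtensDl !epDem gtens1.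
rewrite -[X]mulr1 -[Y]mulr1 -E !(mulrDr X) !(mulrDr Y).
by rewrite !e // !inE eqxx ?orbT.
Qed.

Lemma Theta'_a_b_ep : u * (lam b * ep) = lam b * ep * lam a.
Proof.
by rewrite -ep_central mulrA Theta'_a_ep -ep_central -!mulrA -!lamM Q_ba.
Qed.

Lemma Theta'_a_b_em : u * (lam b * em) = lam b * em * lam a^-1%g.
Proof.
by rewrite -em_central mulrA Theta'_a_em -em_central -!mulrA -!lamM baV.
Qed.

(** On a mixed block both sides are [(b ep (x) em) (a (x) a)] up to the order of the
    factors, by [b a = a^-1 b]; on [em (x) em] they are
    [- (b em (x) b em) (a^-1 (x) a^-1)], by [b a^-1 = a b]. *)
Lemma Omega'2_twist : Om * Om * Delta_s u = gtens u u * (Om * Om).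
Proof.
apply: gtens_ep_emP => x y; rewrite -(mulrA (Om * Om)) -(mulrA (gtens u u)).
have Omega'2_ep_ep : Om * Om * gtens ep ep = gtens ep ep.
  by rewrite -mulrA Omega'_ep Omega'_ep.
rewrite !inE => /orP[] /eqP-> /orP[] /eqP->.
- rewrite (Delta_s_uE zq_epZ zq_epZ) ?mul1r // Omega'2_ep_ep gtensM Theta'_a_ep.
  by rewrite -ep_central -gtensM mulrA Omega'2_ep_ep gtensM.
- rewrite (Delta_s_uE' zq_epZ zq_emZ) ?mul1r // Omega'2_ep_em gtensM Theta'_a_em.
  rewrite -ep_central -em_central -gtensM mulrA Omega'2_ep_em gtensM.
  by rewrite Theta'_a_b_ep (em_central (lam a)).
- rewrite (Delta_s_uE' zq_emZ zq_epZ) ?mulr1 // Omega'2_em_ep gtensM Theta'_a_em.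
  rewrite -ep_central -em_central -gtensM mulrA Omega'2_em_ep gtensM.
  by rewrite Theta'_a_b_ep (em_central (lam a)).
- rewrite (Delta_s_uE zq_emZ zq_emZ) ?mulrNN ?mul1r // -em_central -gtensM [LHS]mulrA.
  rewrite Omega'2_em_em mulNr mulrN !gtensM.
  by rewrite Theta'_a_b_em.
Qed.

(** Multiply the previous identity by [Omega'^*] on both sides. *)
Lemma comul_Theta'_a : Om * Delta_s u * gstar Om = gstar Om * gtens u u * Om.
Proof.
have UU := Omega'_unitary C n; have UU' := Omega'_unitary' C n.
rewrite -[LHS]mul1r -UU' -!mulrA (mulrA Om Om) (mulrA (Om * Om)) Omega'2_twist.
by rewrite -!mulrA UU mulr1.
Qed.

(** [Theta'] maps [Omega'] to [Omega'^*], so on [a] the compatibility with the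
    coproduct is the preceding lemma, and on [b] both coproducts are diagonal. *)
Lemma kac_Theta' : kac_automorphism (@Delta C n) (@Theta' C n).
Proof.
have [F [eF Fa Fb]] := Theta'_lrmorphism; have [FO FO'] := Omega'_inv Fb.
split.
- exact: qext_is_linear.
- exact: Theta'_mul.
- exact: qext1.
- rewrite -eF; apply: star_of_generators; rewrite ?Fa ?Fb ?lam_unitary //.
  exact: Theta'_a_unitary.
- exact: Theta'_bij.
rewrite -eF; apply: comul_of_generators.
  rewrite Fa /Delta comul_Theta'_a Delta_s_lam !gtens_mapM FO FO' gtens_mapE /=.
  by rewrite Fa.
have bV : (b^-1 = b ^+ 3)%g by apply/eqP; rewrite eq_invg_mul -expgS b4.
rewrite -{2}(expg1 b) Delta_b gtens_mapE expg1 /= Fb bV; exact: Delta_b.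
Qed.

Lemma Theta_comm k : odd k -> Theta k \o @Theta' C n = @Theta' C n \o Theta k.
Proof.
move=> ok; have [F [eF Fa Fb]] := Theta'_lrmorphism; have Fz := lrmorphism_zq_inv Fb.
have [G eG] := Theta_lrmorphism ok.
have Ga : G (lam a) = lam (a ^+ k)%g by rewrite eG /Theta qext_a.
have Gb : G (lam b) = lam b by rewrite eG /Theta qext_b.
have Gz := lrmorphism_zq_fix Gb; have GV := lrmorphism_lamV Ga.
have uX l : u ^+ l * ep = lam (a ^- l)%g * ep /\ u ^+ l * em = lam (a ^+ l)%g * em.
  elim: l => [|l [IHl IHl']]; first by rewrite expr0 expg0 invg1 lam1.
  rewrite exprS -!mulrA IHl IHl' -ep_central -em_central !mulrA Theta'_a_ep Theta'_a_em.
  rewrite -!mulrA ep_central em_central !mulrA -!lamM -invMg.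
  by rewrite -expgSr -expgS.
apply/funext; rewrite -eF -eG; apply: (@lrmorphism_eq _ _ (G \o F) (F \o G)) => /=.
  rewrite Fa Ga lamX rmorphXn /= Fa {1}Theta'_aE rmorphD !rmorphM /= Ga GV.
  rewrite lrmorphism_em // lrmorphism_ep // -[RHS]mulr1 -(epDem C n).
  rewrite (mulrDr (u ^+ k)) addrC.
  by have [-> ->] := uX k.
by rewrite Fb Gb Fb (lrmorphism_lamV Gb).
Qed.

End Converse.

(** * The semidirect product *)

Section TrivialAction.
Variables (aT rT : finGroupType) (D : {group aT}) (R : {group rT}).

Definition triv_act (x : rT) (_ : aT) : rT := x.

Lemma triv_is_action : is_action D triv_act.
Proof. by split=> [_ x y //|x y z _ _]. Qed.

Definition triv_action := Action triv_is_action.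

Lemma triv_is_groupAction : is_groupAction R triv_action.
Proof.
move=> y Dy; suff -> : actperm triv_action y = 1%g by apply: group1.
by apply/permP=> x; rewrite actpermE perm1.
Qed.

Definition triv_groupAction : groupAction D R := GroupAction triv_is_groupAction.

End TrivialAction.

Section Parametrization.
Variables (C : numClosedFieldType) (n : nat).
Hypothesis hn : (3 <= n)%N.
Let n0 : (0 < n)%N. Proof. exact: leq_trans hn. Qed.
Local Notation K := (galg C (Qn n)).
Local Notation a := (Qa n).
Local Notation b := (Qb n).

(** If [f] inverts [b] then [f Theta'] fixes it, and [Theta'] is an involution. *)
Lemma Aut_KQ_eq : Aut_KQ C n = A2n C n.
Proof.
apply/seteqP; split=> f /=; last first.
  case=> k ck [] ->; first exact: kac_Theta.
  exact: kac_comp (kac_Theta C n0 ck) (kac_Theta' C n0).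
move=> kf; have [fl fm f1 _ fb fD] := kf.
have [F eF] := lrmorphism_of fl fm f1; rewrite -eF in fb fD.
case: (aut_b hn fb fD) => Fb.
  have [k ck e] := aut_Theta hn fb fD Fb; exists k => //.
  by left; rewrite -eF; apply: funext e.
have [gl gm g1 _ gb gD] := kac_comp kf (kac_Theta' C n0).
have [G eG] := lrmorphism_of gl gm g1; rewrite -eG in gb gD.
have [H [eH _ Hb]] := Theta'_lrmorphism C n0.
have Gb : G (lam b) = lam b.
  by rewrite eG /= -eH Hb -eF (lrmorphism_lamV Fb) invgK.
have [k ck e] := aut_Theta hn gb gD Gb; exists k => //; right.
have <- : (G : K -> K) = Theta k by apply: funext.
by rewrite eG -[RHS]/(f \o (@Theta' C n \o @Theta' C n)) Theta'K.
Qed.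

Definition ThetaTheta' (s : bool) (k : nat) : K -> K :=
  Theta k \o (if s then @Theta' C n else id).

Lemma ThetaTheta'_comp s t k l : odd k -> odd l ->
  ThetaTheta' s k \o ThetaTheta' t l = ThetaTheta' (s (+) t) (k * l).
Proof.
move=> ok ol; have e : ThetaTheta' s k \o ThetaTheta' t l =
    (Theta k \o Theta l) \o ((if s then @Theta' C n else id) \o
      (if t then @Theta' C n else id)) :> (K -> K).
  apply/funext=> x /=; congr (Theta k _).
  case: s; last by [].
  exact: (congr1 (fun F : K -> K => F _) (esym (Theta_comm C n0 ol))).
rewrite e (ThetaM C n0 ok ol) /ThetaTheta'; congr (_ \o _).
by case: s {e}; [case: t; [exact: Theta'K | by []] | by []].
Qed.

Lemma ThetaTheta'_mod s k l : k = l %[mod 2 * n] -> ThetaTheta' s k = ThetaTheta' s l.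
Proof. by move=> kl; rewrite /ThetaTheta' (Theta_mod C kl). Qed.

Lemma ThetaTheta'_b s k : odd k ->
  ThetaTheta' s k (lam b) = lam (if s then b^-1 else b)%g.
Proof.
move=> ok; have [G eG] := Theta_lrmorphism C n0 ok.
have [H [eH _ Hb]] := Theta'_lrmorphism C n0.
have Gb : G (lam b) = lam b by rewrite eG /Theta qext_b.
by case: s; rewrite /ThetaTheta' /= -?eH ?Hb -eG // (lrmorphism_lamV Gb).
Qed.

(** The value at [b] determines [s]; then the involution can be cancelled and the
    value at [a] determines [k]. *)
Lemma ThetaTheta'_inj s t k l : odd k -> odd l -> (k < 2 * n)%N -> (l < 2 * n)%N ->
  ThetaTheta' s k = ThetaTheta' t l -> s = t /\ k = l.
Proof.
move=> ok ol k2 l2 e.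
have bb : (b == b^-1)%g = false.
  apply/negbTE; rewrite QbV -{1}[b]mul1g (inj_eq (mulIg b)) eq_sym; exact: zq_neq1.
have st : s = t.
  have := congr1 (fun F : K -> K => F (lam b)) e.
  rewrite !ThetaTheta'_b // => /lam_inj/eqP.
  by case: s t {e} => [] []; rewrite // ?(eq_sym b^-1%g) bb.
split=> //; rewrite -st in e.
pose tw : K -> K := if s then @Theta' C n else id.
have twK x : tw (tw x) = x.
  rewrite /tw; case: (s); last exact: erefl.
  exact: (congr1 (fun F : K -> K => F x) (Theta'K C n0)).
have {}e : Theta k (tw (tw (lam a))) = Theta l (tw (tw (lam a))) :> K :=
  congr1 (fun F : K -> K => F (tw (lam a))) e.
rewrite twK in e.
move: e; rewrite /Theta !qext_a => /lam_inj; rewrite !Q_aX => /(congr1 fst) /=.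
by move=> /(congr1 val) /=; rewrite !val_Zp_nat ?modn_small //; lia.
Qed.

Lemma card_eq_finType (T : finType) : ([set: T] #= `I_#|T|)%card.
Proof.
apply: card_esym; apply: card_eq_trans card_II _.
have <- : range (@enum_val T T) = setT.
  apply/seteqP; split=> // x _; exists (enum_rank x) => //; exact: enum_rankK.
by apply: card_esym; apply: inj_card_eq => x y _ _; apply: enum_val_inj.
Qed.

Lemma card_sdprod_by (aT rT : finGroupType) (D : {group aT}) (R : {group rT})
  (to : groupAction D R) : #|{: sdprod_by to}| = (#|D| * #|R|)%N.
Proof. by rewrite card_sub cardsX. Qed.

Local Notation to := (triv_groupAction (Zp_group 2) (units_Zp_group (2 * n))).

(** The factor [Z_2] is written multiplicatively in the semidirect product; its
    nonzero element stands for [Theta']. *)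
Definition Aut_param (x : sdprod_by to) : KQ C n -> KQ C n :=
  ThetaTheta' ((x : _ * _).1 != 0) (val ((x : _ * _).2) : 'Z_(2 * n)).

Lemma unit_Zp_coprime (v : {unit 'Z_(2 * n)}) :
  coprime (val v : 'Z_(2 * n)) (2 * n).
Proof.
have := valP v; rewrite /= -{1}[FinRing.uval v]natr_Zp unitZpE 1?coprime_sym //.
by lia.
Qed.

Lemma odd_unit (v : {unit 'Z_(2 * n)}) : odd (val v : 'Z_(2 * n)).
Proof. exact: odd_coprime (unit_Zp_coprime v). Qed.

Lemma Z2_neq0D (s t : 'Z_2) : (s + t != 0) = (s != 0) (+) (t != 0).
Proof. by case: s t => [[|[|m]] //= i] [[|[|l]] //= j]. Qed.

Lemma Z2_neq0_inj (s t : 'Z_2) : (s != 0) = (t != 0) -> s = t.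
Proof. by case: s t => [[|[|m]] //= i] [[|[|l]] //= j] _; apply: val_inj. Qed.

Lemma Aut_param_morph (x y : sdprod_by to) :
  Aut_param (x * y)%g = Aut_param x \o Aut_param y.
Proof.
case: x y => [[s u] /= su] [[t v] /= tv]; rewrite /Aut_param /=.
rewrite (ThetaTheta'_comp _ _ (odd_unit u) (odd_unit v)).
have -> : (s * t)%g = s + t :> 'Z_2 by [].
rewrite Z2_neq0D; apply: ThetaTheta'_mod.
have e m : (m %% (Zp_trunc (2 * n)).+2 = m %% (2 * n))%N by rewrite Zp_cast //; lia.
by rewrite e modn_mod.
Qed.

Lemma Aut_param_inj : injective Aut_param.
Proof.
case=> [[s u] /= su] [[t v] /= tv]; rewrite /Aut_param /= => /ThetaTheta'_inj.
have lt (w : 'Z_(2 * n)) : (w < 2 * n)%N.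
  by apply: leq_trans (ltn_ord w) _; rewrite Zp_cast //; lia.
case; rewrite ?odd_unit ?lt // => st uv; apply: val_inj => /=; congr pair.
  by apply: Z2_neq0_inj.
by do 2!apply: val_inj.
Qed.

Lemma Aut_param_range : range Aut_param = Aut_KQ C n.
Proof.
rewrite Aut_KQ_eq; apply/seteqP; split=> [_ [[[s u] /= su] _ <-]|f].
  exists (val u : 'Z_(2 * n)); first exact: unit_Zp_coprime.
  by rewrite /Aut_param /ThetaTheta' /=; case: (s != 0); [right | left].
case=> k ck fE; have uk : (k%:R : 'Z_(2 * n)) \is a GRing.unit.
  by rewrite unitZpE 1?coprime_sym //; lia.
have kk : k = (k%:R : 'Z_(2 * n)) %[mod 2 * n].
  by rewrite val_Zp_nat ?modn_mod //; lia.
have mem s : (s, FinRing.unit 'Z_(2 * n) uk) \in finset.setX (Zp 2) (units_Zp (2 * n)).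
  by rewrite inE /= /Zp /= !inE.
case: fE => ->.
- exists (SdPair to (mem 0)); first exact: I.
  exact: esym (ThetaTheta'_mod false kk).
- exists (SdPair to (mem 1)); first exact: I.
  exact: esym (ThetaTheta'_mod true kk).
Qed.

End Parametrization.

Theorem theorem8p1p3 (R : realType) (n : nat) (hn : (3 <= n)%N) :
  [/\ Aut_KQ R[i] n = A2n R[i] n,
      (Aut_KQ R[i] n #= `I_(2 * totient (2 * n)))%card
    & exists (to : groupAction (Zp_group 2) (units_Zp_group (2 * n)))
             (F : sdprod_by to -> (KQ R[i] n -> KQ R[i] n)),
        [/\ injective F, range F = Aut_KQ R[i] n
          & forall x y : sdprod_by to, F (x * y)%g = F x \o F y] ].
Proof.
split; first exact: Aut_KQ_eq.
  rewrite -(Aut_param_range _ hn).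
  apply: card_eq_trans (inj_card_eq (in2W (@Aut_param_inj _ _ hn))) _.
  apply: card_eq_trans (card_eq_finType _) _.
  rewrite card_sdprod_by card_Zp // card_units_Zp //; lia.
exists (triv_groupAction (Zp_group 2) (units_Zp_group (2 * n))), (@Aut_param _ n).
split; [exact: Aut_param_inj | exact: Aut_param_range | exact: Aut_param_morph].
Qed.
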